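(* Let $q_0,p_0,s_0,s,r\in(0,\infty)$ and $r_0,q,p\in(0,\infty]$ satisfy $$\frac1q-\frac1{q_0}=\frac1p-\frac1{p_0}=\frac1s-\frac1{s_0}=\frac1{r_0}-\frac1r<0 .$$ Let $w$ be a weight on $\Omega$ with $[w]_{(s,r)}<\infty$. Assume: (1) there is a function $c:(1,\infty]\to[1,\infty)$ such that $\|\mathcal M\|_{L^t_v(\Omega)\to L^t_v(\Omega)}\le c(t)[v]_t^{t'}$ for all $t\in(1,\infty]$ and all weights $v$ on $\Omega$; (2) there are a set $V$, a map $S:V\to L^0(\Omega)$, a map $$T:\bigcup_{w_0:\,[w_0]_{(s_0,r_0)}<\infty} S^{-1}\big(L^{p_0}_{w_0}(\Omega)\big)\to L^0(\Omega)$$ (union over all weights $w_0$ with $[w_0]_{(s_0,r_0)}<\infty$), and an increasing function $\phi:\mathbb R\to\mathbb R$ such that for every weight $w_0$ with $[w_0]_{(s_0,r_0)}<\infty$ and every $f\in S^{-1}(L^{p_0}_{w_0}(\Omega))$, $$\|Tf\|_{L^{q_0}_{w_0}(\Omega)}\le \phi([w_0]_{(s_0,r_0)})\,\|Sf\|_{L^{p_0}_{w_0}(\Omega)}.$$ Then $S^{-1}(L^p_w(\Omega))$ is contained in the domain of $T$, and for every $\kappa\in(1,\infty)$ and every $f\in S^{-1}(L^p_w(\Omega))$, $$\|Tf\|_{L^q_w(\Omega)}\le \kappa^{\beta}\,\phi\Big((\kappa' c(t))^{\beta}[w]_{(s,r)}^{s/s_0}\Big)\,\|Sf\|_{L^p_w(\Omega)},$$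 where $t:=(\frac1s+\frac1r)/\frac1r$ and $\beta:=(\frac1s+\frac1r)(\frac1r-\frac1{r_0})/\frac1r$.
   Context: $(\Omega,\mu)$ is a $\sigma$-finite measure space with a fixed basis of sets $\mathcal U$: a countable collection of measurable sets $U$ with $0<\mu(U)<\infty$ such that $\bigcup_{U\in\mathcal U}U=\Omega$ and for all $x,y\in\Omega$ there is $U\in\mathcal U$ with $x,y\in U$. A weight is a measurable function $w:\Omega\to(0,\infty)$. $L^0(\Omega)$ denotes the measurable functions on $\Omega$. For $p\in(0,\infty]$ and a weight $w$, $L^p_w(\Omega)$ is the space of measurable $f$ with $\|f\|_{L^p_w(\Omega)}:=\|fw\|_{L^p(\Omega)}<\infty$ (the weight multiplies the function, not the measure). For $s,r\in(0,\infty]$ and weights $w,v$, $$[w,v]_{(s,r)}:=\sup_{U\in\mathcal U}\mu(U)^{-\frac1s-\frac1r}\|w\|_{L^s(U)}\|v^{-1}\|_{L^r(U)}\quad(\tfrac1\infty:=0),$$ $[w]_{(s,r)}:=[w,w]_{(s,r)}$, and for $p\in[1,\infty]$, $[w,v]_p:=[w,v]_{(p,p')}$, $[w]_p:=[w,w]_p$, where $p'$ is the Hölder conjugate exponent. The maximal operator is $\mathcal Mf:=\sup_{U\in\mathcal U}\mu(U)^{-1}\|f\|_{L^1(U)}\mathbf 1_U$. For $\kappa\in(1,\infty)$, $\kappa'=\kappa/(\kappa-1)$. $\|\mathcal M\|_{X\to Y}$ denotes $\sup\{\|\mathcal Mf\|_Y:\|f\|_X\le1\}$. *)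

(* Defs.v *)
From HB Require Import structures.
From mathcomp Require Import all_boot all_order all_algebra.
From mathcomp Require Import all_classical all_reals all_analysis.
Set Implicit Arguments. Unset Strict Implicit. Unset Printing Implicit Defensive.
Import Order.TTheory GRing.Theory Num.Theory.
Import numFieldNormedType.Exports.
Local Open Scope classical_set_scope.
Local Open Scope ring_scope.

Section Defs.
Context {R : realType} {d : measure_display} {Om : measurableType d}.
Variable mu : {measure set Om -> \bar R}.

Definition inv_e (p : \bar R) : R :=
  match p with r%:E => r^-1 | _ => 0 end.

(* Hoelder conjugate exponent t' of t in [1,oo] (value on other inputs irrelevant) *)
Definition hconj (t : \bar R) : \bar R :=
  match t with
  | r%:E => if r == 1 then +oo%E else (r / (r - 1))%:E
  | +oo%E => 1%E
  | -oo%E => 0%E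
  end.

Definition is_basis (U : nat -> set Om) : Prop :=
  (forall i, measurable (U i) /\ (0 < mu (U i))%E /\ (mu (U i) < +oo)%E) /\
  \bigcup_i U i = [set: Om] /\
  (forall x y, exists i, U i x /\ U i y).

Definition weight (w : Om -> R) : Prop :=
  measurable_fun [set: Om] w /\ forall x, 0 < w x.

Definition inLw (p : \bar R) (w : Om -> R) (f : Om -> R) : Prop :=
  measurable_fun [set: Om] f /\ (Lnorm mu p (fun x => (f x * w x)%:E) < +oo)%E.

Definition char (U : nat -> set Om) (s r : \bar R) (w v : Om -> R) : \bar R :=
  ereal_sup (range (fun i =>
    ((fine (mu (U i))) `^ (- (inv_e s + inv_e r)))%:E
    * Lnorm mu s (fun x => (\1_(U i) x * w x)%:E)
    * Lnorm mu r (fun x => (\1_(U i) x * (v x)^-1)%:E))%E).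

Definition maxop (U : nat -> set Om) (f : Om -> R) : Om -> \bar R :=
  fun x => ereal_sup (range (fun i =>
    ((fine (mu (U i)))^-1)%:E * Lnorm mu 1 (fun y => (\1_(U i) y * f y)%:E)
    * (\1_(U i) x)%:E)%E).

Definition Mnorm (U : nat -> set Om) (t : \bar R) (v : Om -> R) : \bar R :=
  ereal_sup [set Lnorm mu t (fun x => (maxop U f x * (v x)%:E)%E) |
             f in [set f : Om -> R | measurable_fun [set: Om] f /\
                     (Lnorm mu t (fun x => (f x * v x)%:E) <= 1)%E]].
End Defs.

(* Main.v *)
(** Put dl := 1/p0 - 1/p > 0. Then 1/q0 = 1/q + dl, so by duality it suffices
    to bound ||Tf w k^dl||_(q0) for k > 0 with integral at most 1. Let
    t := (1/s + 1/r) r, so that beta = t dl. The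
    Rubio de Francia algorithm for M on L^t_v, where v := w^(-1/sg) and
    sg := 1/s + 1/r, dominates k by some h = (g v)^t with integral at most
    kappa^t and with g an A_1-weight: M g <= kappa' c(t) [w]_(s,r)^s g. As
    w h^dl = g^beta w^(1 - r dl), the A_1 condition together with Hoelder's
    inequality shows that w0 := w h^dl has
    [w0]_(s0,r0) <= (kappa' c(t) [w]_(s,r)^s)^beta [w]_(s,r)^(1 - r dl),
    and the hypothesis on T for the weight w0, followed by Hoelder's inequality
    with 1/p0 = 1/p + dl, gives the claim. *)

Require Import Defs.
From HB Require Import structures.
From mathcomp Require Import all_boot all_order all_algebra.
From mathcomp Require Import all_classical all_reals all_analysis.
From mathcomp Require Import measurable_realfun ess_sup_inf.
From mathcomp Require Import ring.
Set Implicit Arguments. Unset Strict Implicit. Unset Printing Implicit Defensive.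
Import Order.TTheory GRing.Theory Num.Theory.
Import numFieldNormedType.Exports.
Local Open Scope classical_set_scope.
Local Open Scope ring_scope.

(** The test function k carries no regularity, so [w k^dl] need not lie in the weight class on which
    T is controlled. It is replaced by a majorant h whose integral is still bounded, which costs
    only the factor (kappa^t)^dl = kappa^beta in Hoelder's inequality. The weight v is chosen so
    that v^t = w^(-r) and v^(-t') = w^s with t' = s sg. Hence the class of w becomes the class A_t
    of v, and [v]_t^t' is controlled by [w]_(s,r)^s, which is where that power comes from. The power
    t in h = (g v)^t makes the integral of h the t-th power of the L^t_v norm of g. In the constant
    of w0 the two factors are treated differently: Hoelder bounds the norm of w0 by a power of the
    integral of g, the pointwise A_1 bound gives the inverse power for w0^(-1), and these cancel.
    Thus only the A_1 constant of g survives. Two points shape the details: k must be strictly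
    positive for w0 to be a weight, and p, q, r0 may be infinite, which makes one interpolation
    exponent degenerate and calls for separate arguments. *)

Lemma lee_poweR2r (R : realType) (r : R) (x y : \bar R) :
  0 <= r -> (0 <= x)%E -> (x <= y)%E -> (x `^ r <= y `^ r)%E.
Proof.
move=> r0 x0 xy; apply: gt0_ler_poweR => //; rewrite in_itv/= leey ?x0//.
by rewrite (le_trans x0 xy).
Qed.

Lemma ler_powR2r (R : realType) (r x y : R) :
  0 <= r -> 0 <= x -> x <= y -> x `^ r <= y `^ r.
Proof.
by move=> r0 x0 xy; apply: ge0_ler_powR => //; rewrite nnegrE// (le_trans x0).
Qed.

(** * Hoelder's inequality and norms of nonnegative functions *)

Section Integrals.
Context {R : realType} {d : measure_display} {Om : measurableType d}.
Variable mu : {measure set Om -> \bar R}.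

Lemma measurable_fun_powR (D : set Om) (f : Om -> R) (p : R) :
  measurable_fun D f -> measurable_fun D (fun x => f x `^ p).
Proof. exact: (@measurableT_comp _ _ _ _ _ _ (@powR R ^~ p)). Qed.

Lemma measurable_fun_inv (D : set Om) (f : Om -> R) :
  (forall x, 0 < f x) -> measurable_fun D f ->
  measurable_fun D (fun x => (f x)^-1).
Proof.
move=> f0 mf; rewrite (_ : (fun _ => _) = (fun x => f x `^ (-1))).
  exact: measurable_fun_powR.
by apply/funext => x; rewrite powR_inv1// ltW.
Qed.

Lemma Lnorm_ge0E (p : R) (f : Om -> R) : (forall x, 0 <= f x) ->
  Lnorm mu p%:E (fun x => (f x)%:E)
  = ((\int[mu]_x (f x `^ p)%:E) `^ p^-1)%E.
Proof.
move=> f0; rewrite unlock.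
by under eq_integral do rewrite /= ger0_norm ?f0//.
Qed.

Lemma Lnorm_indic (p : R) (D : set Om) (f : Om -> R) :
  0 < p -> (forall x, 0 <= f x) ->
  Lnorm mu p%:E (fun x => (\1_D x * f x)%:E)
  = ((\int[mu]_(x in D) (f x `^ p)%:E) `^ p^-1)%E.
Proof.
move=> p0 f0; rewrite Lnorm_ge0E; last by move=> x; rewrite mulr_ge0.
rewrite [in RHS]integral_mkcond.
apply: (congr1 (fun I => I `^ p^-1)%E); apply: eq_integral => x _.
rewrite patchE indicE; case: (x \in D); first by rewrite mul1r.
by rewrite mul0r powR0// gt_eqF.
Qed.

(* Hoelder's inequality with exponents 1/th and 1/(1-th), written without
   norms; the conventions [x `^ 0 = 1] make it hold at th = 0 and th = 1. *)
Lemma integral_powR_interpolation (D : set Om) (a b : Om -> R) (th : R) :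
  measurable D -> measurable_fun [set: Om] a -> measurable_fun [set: Om] b ->
  (forall x, 0 <= a x) -> (forall x, 0 <= b x) -> 0 <= th <= 1 ->
  (\int[mu]_(x in D) (a x `^ th * b x `^ (1 - th))%:E
   <= (\int[mu]_(x in D) (a x)%:E) `^ th
      * (\int[mu]_(x in D) (b x)%:E) `^ (1 - th))%E.
Proof.
move=> mD ma mb a0 b0 /andP[th0 th1].
have Ia : (0 <= \int[mu]_(x in D) (a x)%:E)%E.
  by apply: integral_ge0 => x _; rewrite lee_fin.
have Ib : (0 <= \int[mu]_(x in D) (b x)%:E)%E.
  by apply: integral_ge0 => x _; rewrite lee_fin.
have [->|thN0] := eqVneq th 0.
  rewrite subr0 poweRe0 mul1e poweRe1//.
  by under eq_integral do rewrite powRr0 mul1r powRr1//.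
have [->|thN1] := eqVneq th 1.
  rewrite subrr poweRe0 mule1 poweRe1//.
  by under eq_integral do rewrite powRr0 mulr1 powRr1//.
have {thN0}th0 : 0 < th by rewrite lt_neqAle eq_sym thN0.
have {thN1}th1 : 0 < 1 - th by rewrite subr_gt0 lt_neqAle thN1.
have pa x : 0 <= a x `^ th by exact: powR_ge0.
have pb x : 0 <= b x `^ (1 - th) by exact: powR_ge0.
have mf : measurable_fun [set: Om] (fun x => \1_D x * a x `^ th).
  by apply: measurable_funM => //; exact: measurable_fun_powR.
have mg : measurable_fun [set: Om] (fun x => \1_D x * b x `^ (1 - th)).
  by apply: measurable_funM => //; exact: measurable_fun_powR.
have H := @hoelder _ _ _ mu _ _ th^-1 (1 - th)^-1 mf mg.
rewrite !invrK !invr_gt0 in H.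
have {H} := H th0 th1 (subrKC _ _).
rewrite Lnorm1 (@Lnorm_indic th^-1 D (fun x => a x `^ th)) ?invr_gt0//.
rewrite (@Lnorm_indic (1 - th)^-1 D (fun x => b x `^ (1 - th))) ?invr_gt0//.
rewrite !invrK.
under [X in (_ <= X `^ _ * _)%E]eq_integral
  do rewrite -powRrM mulfV ?gt_eqF// powRr1//.
under [X in (_ <= _ * X `^ _)%E]eq_integral
  do rewrite -powRrM mulfV ?gt_eqF// powRr1//.
move=> /(le_trans _); apply.
rewrite integral_mkcond le_eqVlt; apply/orP; left; apply/eqP/eq_integral => x _.
rewrite patchE /= indicE; case: (x \in D) => /=.
  by rewrite !mul1r ger0_norm// mulr_ge0// powR_ge0.
by rewrite !mul0r normr0.
Qed.

Lemma Lnorm_normr (p : \bar R) (f : Om -> R) :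
  Lnorm mu p (fun x => (f x)%:E) = Lnorm mu p (fun x => (`|f x|)%:E).
Proof. by rewrite -Lnorm_abse. Qed.

Lemma Lnorm_leP (p c : R) (f : Om -> R) : 0 < p -> 0 <= c ->
  (forall x, 0 <= f x) ->
  (Lnorm mu p%:E (fun x => (f x)%:E) <= c%:E)%E
  <-> (\int[mu]_x (f x `^ p)%:E <= (c `^ p)%:E)%E.
Proof.
move=> p0 c0 f0; rewrite Lnorm_ge0E//.
have I0 : (0 <= \int[mu]_x (f x `^ p)%:E)%E.
  by apply: integral_ge0 => x _; rewrite lee_fin powR_ge0.
have p1 := ltW p0; split => [/lee_poweR2r|/lee_poweR2r] H.
- have := H p p1 (poweR_ge0 _ _).
  by rewrite -poweRrM mulVf ?gt_eqF// poweRe1// poweR_EFin.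
- have := H p^-1 _ I0; rewrite invr_ge0 => /(_ p1).
  by rewrite poweR_EFin -powRrM mulfV ?gt_eqF// powRr1.
Qed.

Lemma Lnorm_Zge0 (p c : R) (f : Om -> R) : 0 < p -> 0 <= c ->
  measurable_fun [set: Om] f -> (forall x, 0 <= f x) ->
  Lnorm mu p%:E (fun x => (c * f x)%:E)
  = (c%:E * Lnorm mu p%:E (fun x => (f x)%:E))%E.
Proof.
move=> p0 c0 mf f0; rewrite !Lnorm_ge0E//; last by move=> x; rewrite mulr_ge0.
under eq_integral do rewrite powRM// EFinM.
rewrite ge0_integralZl_EFin ?powR_ge0//; last 2 first.
- by move=> x _; rewrite lee_fin powR_ge0.
- by apply/measurable_EFinP; exact: measurable_fun_powR.
rewrite poweRM ?lee_fin ?powR_ge0//; last first.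
  by apply: integral_ge0 => x _; rewrite lee_fin powR_ge0.
by rewrite poweR_EFin -powRrM mulfV ?gt_eqF// powRr1.
Qed.

Lemma le_Lnorm_ge0 (p : R)
  (f g : Om -> R) : 0 < p ->
  measurable_fun [set: Om] f -> measurable_fun [set: Om] g ->
  (forall x, 0 <= f x) -> (forall x, f x <= g x) ->
  (Lnorm mu p%:E (fun x => (f x)%:E) <= Lnorm mu p%:E (fun x => (g x)%:E))%E.
Proof.
move=> p0 mf mg f0 fg; have g0 x : 0 <= g x by exact: le_trans (fg x).
rewrite (Lnorm_ge0E _ f0) (Lnorm_ge0E _ g0); apply: lee_poweR2r.
- by rewrite invr_ge0 ltW.
- by apply: integral_ge0 => x _; rewrite lee_fin powR_ge0.
apply: ge0_le_integral => //.
- by move=> x _; rewrite lee_fin powR_ge0.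
- by apply/measurable_EFinP; exact: measurable_fun_powR.
- by apply/measurable_EFinP; exact: measurable_fun_powR.
- by move=> x _; rewrite lee_fin; apply: ler_powR2r; rewrite ?(ltW p0).
Qed.

Lemma ae_eq0_Lnorm (p : \bar R)
  (f : Om -> R) : (0 < p)%E -> (0 < mu [set: Om])%E ->
  measurable_fun [set: Om] f -> {ae mu, forall x, f x = 0} ->
  Lnorm mu p (fun x => (f x)%:E) = 0%E.
Proof.
move=> p_gt0 muT mf f0; case: p p_gt0 => [p|_|//].
- rewrite lte_fin => p0; rewrite Lnorm_normr Lnorm_ge0E//.
  have fp0 : ae_eq mu [set: Om] (fun x => (`|f x| `^ p)%:E) (cst 0%E).
    by apply: filterS f0 => x -> _; rewrite normr0 powR0// gt_eqF.
  rewrite (ge0_ae_eq_integral _ _ _ _ _ fp0)//.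
  + by rewrite integral0 poweR0r// invr_neq0// gt_eqF.
  + by apply/measurable_EFinP/measurable_fun_powR; exact: measurableT_comp.
- rewrite unlock muT; apply: abs_ess_sup_eq0 => //.
  by apply: filterS f0 => x -> _.
Qed.

(** Hoelder's inequality with 1/p0 = 1/p + dl, where k^dl has L^(1/dl) norm equal to the dl-th power
    of the integral of k. For finite p one interpolates between k and f^p with exponent dl p0. For p
    infinite, dl p0 = 1 and f is almost everywhere at most its norm. *)
Lemma Lnorm_mul_powR_le (p0 dl c : R) (p : \bar R) (f k : Om -> R) :
  (0 < mu [set: Om])%E -> 0 < p0 -> 0 < dl -> (0 < p)%E ->
  inv_e p = p0^-1 - dl -> 0 < c ->
  measurable_fun [set: Om] f -> measurable_fun [set: Om] k ->
  (forall x, 0 <= f x) -> (forall x, 0 <= k x) ->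
  (\int[mu]_x (k x)%:E <= c%:E)%E ->
  (Lnorm mu p0%:E (fun x => (f x * k x `^ dl)%:E)
   <= (c `^ dl)%:E * Lnorm mu p (fun x => (f x)%:E))%E.
Proof.
move=> muT p0_gt0 dl_gt0 p_gt0 pE c0 mf mk f0 k0 kc.
have p0N : p0 != 0 by rewrite gt_eqF.
have dl0 := ltW dl_gt0; have p00 := ltW p0_gt0; have c0' := ltW c0.
have fk0 x : 0 <= f x * k x `^ dl by rewrite mulr_ge0 ?powR_ge0.
have Ik : (0 <= \int[mu]_x (k x)%:E)%E.
  by apply: integral_ge0 => x _; rewrite lee_fin.
have Ifk : (0 <= \int[mu]_x ((f x * k x `^ dl) `^ p0)%:E)%E.
  by apply: integral_ge0 => x _; rewrite lee_fin powR_ge0.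
have mfk : measurable_fun [set: Om] (fun x => (f x * k x `^ dl) `^ p0).
  apply: measurable_fun_powR; apply: measurable_funM => //.
  exact: measurable_fun_powR.
have ip0 : 0 <= p0^-1 by rewrite invr_ge0.
rewrite Lnorm_ge0E//; case: p p_gt0 pE => [b|_|//] /=.
- rewrite lte_fin => b0 bE; have bN : b != 0 by rewrite gt_eqF.
  have th : 1 - dl * p0 = p0 / b by rewrite bE mulrBr mulfV// mulrC.
  have th01 : 0 <= dl * p0 <= 1.
    by rewrite mulr_ge0//= -subr_ge0 th divr_ge0// ltW.
  have mfb : measurable_fun [set: Om] (fun x => f x `^ b)
    by exact: measurable_fun_powR.
  have := integral_powR_interpolation measurableT mk mfb k0
    (fun x => powR_ge0 _ _) th01.
  have -> : (\int[mu]_x (k x `^ (dl * p0) * (f x `^ b) `^ (1 - dl * p0))%:E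
             = \int[mu]_x ((f x * k x `^ dl) `^ p0)%:E)%E.
    apply: eq_integral => x _; congr EFin.
    rewrite (powRM _ (f0 x) (powR_ge0 _ _)) -!powRrM mulrC th.
    by have -> : b * (p0 / b) = p0 by rewrite mulrCA mulfV// mulr1.
  move=> /(lee_poweR2r ip0 Ifk) /le_trans; apply.
  rewrite poweRM ?poweR_ge0// -!poweRrM mulfK// th Lnorm_ge0E// lee_pmul
    ?poweR_ge0//.
    by rewrite -poweR_EFin; apply: lee_poweR2r.
  have -> : p0 / b / p0 = b^-1 by field; rewrite p0N bN.
  exact: lexx.
move=> /esym/eqP; rewrite subr_eq0 => /eqP dlE.
set N := Lnorm mu _ _.
have fN : {ae mu, forall x, ((f x)%:E <= N)%E}.
  rewrite /N unlock muT.
  apply: filterS (ess_sup_ge mu (abse \o (fun x => (f x)%:E))) => x.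
  by rewrite /= ger0_norm.
have N0 : (0 <= N)%E by exact: Lnorm_ge0.
case: N N0 fN => [N N0 fN|_ _|//]; last first.
  by rewrite gt0_muley ?leey// lte_fin powR_gt0.
rewrite lee_fin in N0.
apply: (@le_trans _ _ (((N `^ p0)%:E * c%:E) `^ p0^-1)%E); last first.
  rewrite -EFinM poweR_EFin -EFinM lee_fin powRM ?powR_ge0// -powRrM mulfV//.
  by rewrite powRr1// mulrC dlE.
apply: lee_poweR2r => //.
apply: (@le_trans _ _ ((N `^ p0)%:E * \int[mu]_x (k x)%:E)%E); last first.
  by rewrite lee_wpmul2l// lee_fin powR_ge0.
rewrite -ge0_integralZl_EFin ?powR_ge0//; last 2 first.
- by move=> x _; rewrite lee_fin.
- exact/measurable_EFinP.
apply: ae_ge0_le_integral => //.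
- by move=> x _; rewrite lee_fin powR_ge0.
- exact/measurable_EFinP.
- by move=> x _; rewrite -EFinM lee_fin mulr_ge0 ?powR_ge0.
- by apply: measurable_funeM; exact/measurable_EFinP.
apply: filterS fN => x; rewrite lee_fin => fx _.
rewrite -EFinM lee_fin powRM ?powR_ge0// -powRrM -dlE mulVf// powRr1//.
by rewrite ler_wpM2r//; apply: ler_powR2r.
Qed.

End Integrals.

(** Passage to the limit eps -> 0: solving the hypothesis for [N + eps] reduces it to the additive
    case. *)
Lemma le_mul_powR_lim (R : realType) (th M N c : R) :
  0 < th -> 0 <= M -> 0 <= N -> 0 <= c ->
  (forall eps, 0 < eps -> M <= c * (N + eps) `^ th) -> M <= c * N `^ th.
Proof.
move=> th0 M0 N0; rewrite le_eqVlt => /predU1P[<-|c0] H.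
  by have := H 1 ltr01; rewrite !mul0r.
have c1 := ltW c0; have th1 := ltW th0.
have X eps : 0 < eps -> (M / c) `^ th^-1 <= N + eps.
  move=> eps0; have NE : 0 <= N + eps by rewrite addr_ge0// ltW.
  rewrite -[leRHS](powRr1 NE) -(@mulfV _ th) ?gt_eqF// powRrM.
  apply: ler_powR2r; rewrite ?invr_ge0 ?divr_ge0//.
  by rewrite ler_pdivrMr// mulrC H.
have {}X : (M / c) `^ th^-1 <= N by apply/ler_addgt0Pr => eps /X.
rewrite mulrC -ler_pdivrMr// -[leLHS]powRr1 ?divr_ge0//.
rewrite -(@mulVf _ th) ?gt_eqF// powRrM.
by apply: ler_powR2r; rewrite ?powR_ge0.
Qed.

(** * Duality: the L^q norm recovered from weighted L^(q0) norms *)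

Section Duality.
Context {R : realType} {d : measure_display} {Om : measurableType d}.
Variable mu : {measure set Om -> \bar R}.

(** This function makes nonnegative test functions strictly positive, truncates functions to
    integrable ones, and is itself an admissible k when any single one will do. *)
Lemma sigma_finite_pos_integrable : sigma_finite [set: Om] mu ->
  exists e : Om -> R, [/\ measurable_fun [set: Om] e, forall x, 0 < e x &
    (\int[mu]_x (e x)%:E <= 1)%E].
Proof.
case=> F FT mF.
(* The denominator [1 + mu (F i)] bounds both [c i] and [c i * mu (F i)] by 2^-(i+1): the first
   bound makes the series finite everywhere, the second bounds its integral by 1. *)
pose c i : R := 1 / (2 ^ i.+1)%:R / (1 + fine (mu (F i))).
have m0 i : 0 <= fine (mu (F i)) by exact: fine_ge0.
have m1 i : 0 < 1 + fine (mu (F i)) by rewrite ltr_pwDl.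
have c0 i : 0 < c i by rewrite /c !divr_gt0// ltr0n expn_gt0.
pose u i x : \bar R := (c i * \1_(F i) x)%:E.
have u0 i x : (0 <= u i x)%E by rewrite lee_fin mulr_ge0// ltW.
have uc i x : (u i x <= (1 / (2 ^ i.+1)%:R)%:E)%E.
  rewrite lee_fin /c -(mulrA (1 / _)).
  rewrite ler_piMr// ?divr_ge0//.
  rewrite mulrC ler_pdivrMr// mul1r indicE.
  by case: (_ \in _); rewrite ?lerDl// ltW.
pose G x := (\sum_(i <oo) u i x)%E.
have mu_ i : measurable_fun [set: Om] (u i).
  apply/measurable_EFinP/measurable_funM => //.
  by apply: measurable_indic; have [] := mF i.
have mG : measurable_fun [set: Om] G by exact: ge0_emeasurable_sum.
have G0 x : (0 <= G x)%E by exact: nneseries_ge0.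
have Gfin x : G x \is a fin_num.
  rewrite ge0_fin_numE// (@le_lt_trans _ _ 1%E) ?ltry//.
  apply: le_trans (epsilon_trick0 xpredT ler01).
  exact: lee_nneseries.
exists (fun x => fine (G x)); split.
- exact: measurableT_comp.
- move=> x; have [i _ Fx] : (\bigcup_i F i) x by rewrite -FT.
  rewrite fine_gt0// ltey_eq Gfin andbT.
  apply: (@lt_le_trans _ _ (u i x)).
    by rewrite lte_fin indicE mem_set// mulr1.
  apply: le_trans (nneseries_lim_ge i.+1 _) => //.
  by rewrite big_nat_recr//= leeDr// sume_ge0.
- under eq_integral do rewrite fineK//.
  rewrite integral_nneseries//.
  apply: le_trans (epsilon_trick0 xpredT ler01).
  apply: lee_nneseries => [i _ _|i _]; first exact: integral_ge0.
  have [mFi Fioo] := mF i.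
  under eq_integral do rewrite /u EFinM.
  rewrite ge0_integralZl_EFin//; last 2 first.
    exact/measurable_EFinP/measurable_indic.
    exact: ltW.
  rewrite integral_indic// setIT -[mu _]fineK ?ge0_fin_numE//.
  rewrite -EFinM lee_fin /c -(mulrA (1 / _)) ler_piMr// ?divr_ge0//.
  by rewrite mulrC ler_pdivrMr// mul1r lerDr.
Qed.

Section NormTest.
Hypothesis sfmu : sigma_finite [set: Om] mu.
Variables (q0 dl C : R) (F : Om -> R).
Hypotheses (q0_gt0 : 0 < q0) (dl_gt0 : 0 < dl) (C_ge0 : 0 <= C).
Hypotheses (mF : measurable_fun [set: Om] F) (F0 : forall x, 0 <= F x).
Hypothesis HF : forall k : Om -> R, measurable_fun [set: Om] k ->
  (forall x, 0 < k x) -> (\int[mu]_x (k x)%:E <= 1)%E ->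
  (\int[mu]_x (F x `^ q0 * k x `^ (dl * q0))%:E <= (C `^ q0)%:E)%E.

Let th := dl * q0.
Let th0 : 0 < th. Proof. exact: mulr_gt0. Qed.

(* Test with the strictly positive function (h + eps e) / (N + eps), e > 0
   integrable, and let eps tend to 0. *)
Lemma integral_test_le (h : Om -> R) (N : R) :
  measurable_fun [set: Om] h -> (forall x, 0 <= h x) ->
  (\int[mu]_x (h x)%:E = N%:E)%E ->
  (\int[mu]_x (F x `^ q0 * h x `^ th)%:E <= (C `^ q0 * N `^ th)%:E)%E.
Proof.
move=> mh h0 hN.
have [e [me e0 e1]] := sigma_finite_pos_integrable sfmu.
have N0 : 0 <= N
  by rewrite -lee_fin -hN; apply: integral_ge0 => x _; rewrite lee_fin.
have e0' x : 0 <= e x by exact: ltW.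
have mFh : measurable_fun [set: Om] (fun x => F x `^ q0 * h x `^ th).
  by apply: measurable_funM; exact: measurable_fun_powR.
have Fh0 x : 0 <= F x `^ q0 * h x `^ th by rewrite mulr_ge0 ?powR_ge0.
have H eps : 0 < eps ->
    (\int[mu]_x (F x `^ q0 * h x `^ th)%:E <= (C `^ q0 * (N + eps) `^ th)%:E)%E.
  move=> eps0; have Ne : 0 < N + eps by rewrite ltr_wpDl.
  have Ne' := ltW Ne; have eps0' := ltW eps0.
  pose k x := (N + eps)^-1 * (h x + eps * e x).
  have mk : measurable_fun [set: Om] k.
    by apply: measurable_funM => //; apply: measurable_funD => //;
      exact: measurable_funM.
  have k0 x : 0 < k x by rewrite mulr_gt0 ?invr_gt0// ltr_wpDl// mulr_gt0.
  have k0' x := ltW (k0 x).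
  have Ik : (\int[mu]_x (k x)%:E <= 1)%E.
    under eq_integral do rewrite EFinM.
    rewrite ge0_integralZl_EFin ?invr_ge0//; last 2 first.
    - by move=> x _; rewrite lee_fin addr_ge0// mulr_ge0.
    - by apply/measurable_EFinP; apply: measurable_funD => //;
      exact: measurable_funM.
    under eq_integral do rewrite EFinD EFinM.
    rewrite ge0_integralD//; last 4 first.
    - by move=> x _; rewrite lee_fin.
    - exact/measurable_EFinP.
    - by move=> x _; rewrite -EFinM lee_fin mulr_ge0.
    - by under eq_fun do rewrite -EFinM; apply/measurable_EFinP;
      exact: measurable_funM.
    rewrite ge0_integralZl_EFin//; last 2 first.
    - by move=> x _; rewrite lee_fin.
    - exact/measurable_EFinP.
    rewrite hN lee_pdivrMl// mule1 EFinD leeD2l//.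
    by rewrite -[leRHS]mule1 lee_wpmul2l.
  have := HF mk k0 Ik => Hk.
  have le1 : (\int[mu]_x (F x `^ q0 * h x `^ th)%:E <=
      ((N + eps) `^ th)%:E * \int[mu]_x (F x `^ q0 * k x `^ th)%:E)%E.
    rewrite -ge0_integralZl_EFin ?powR_ge0//; last 2 first.
    - by move=> x _; rewrite lee_fin mulr_ge0 ?powR_ge0.
    - by apply/measurable_EFinP/measurable_funM; exact: measurable_fun_powR.
    apply: ge0_le_integral => //.
    - by move=> x _; rewrite lee_fin.
    - exact/measurable_EFinP.
    - under eq_fun do rewrite -EFinM.
      apply/measurable_EFinP/measurable_funM => //.
      by apply: measurable_funM; exact: measurable_fun_powR.
    move=> x _; rewrite -EFinM lee_fin mulrCA ler_wpM2l ?powR_ge0//.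
    rewrite -powRM ?k0'// /k mulrA mulfV ?gt_eqF// mul1r.
    apply: ler_powR2r => //; first exact: ltW.
    by rewrite lerDl mulr_ge0.
  apply: (le_trans le1); rewrite muleC EFinM.
  by rewrite lee_wpmul2r// lee_fin powR_ge0.
have [I|I] := eqVneq (\int[mu]_x (F x `^ q0 * h x `^ th)%:E)%E +oo%E.
  by have := H 1 ltr01; rewrite I leye_eq.
have I0 : (0 <= \int[mu]_x (F x `^ q0 * h x `^ th)%:E)%E.
  by apply: integral_ge0 => x _; rewrite lee_fin.
have If : (\int[mu]_x (F x `^ q0 * h x `^ th)%:E)%E \is a fin_num.
  by rewrite ge0_fin_numE// ltey.
move: H I0; rewrite -(fineK If) lee_fin => H I0.
by rewrite lee_fin; apply: le_mul_powR_lim; rewrite ?powR_ge0.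
Qed.

(* The extremal choice is h = F^q, truncated to be integrable. *)
Lemma Lnorm_le_duality_fin (q : R) : 0 < q -> q^-1 = q0^-1 - dl ->
  (Lnorm mu q%:E (fun x => (F x)%:E) <= C%:E)%E.
Proof.
move=> q_gt0 qE.
have [e [me e0 e1]] := sigma_finite_pos_integrable sfmu.
have thE : 1 - th = q0 / q.
  by rewrite qE mulrBr mulfV ?gt_eqF// /th mulrC.
have qC : 0 < 1 - th by rewrite thE divr_gt0.
pose P x := F x `^ q.
(* Integrable because e is, and increasing to P pointwise because e > 0. *)
pose Pn n x := Num.min (P x) (n%:R * e x).
have P0 x : 0 <= P x by exact: powR_ge0.
have ne0 n x : 0 <= n%:R * e x by rewrite mulr_ge0// ltW.
have Pn0 n x : 0 <= Pn n x by rewrite /Pn le_min P0 ne0.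
have mP : measurable_fun [set: Om] P by exact: measurable_fun_powR.
have mPn n : measurable_fun [set: Om] (Pn n).
  by apply: measurable_minr => //; exact: measurable_funM.
have IPn n : (\int[mu]_x (Pn n x)%:E <= (C `^ q)%:E)%E.
  have lty : (\int[mu]_x (Pn n x)%:E < +oo)%E.
    apply: (@le_lt_trans _ _ (\int[mu]_x (n%:R%:E * (e x)%:E))%E).
      apply: ge0_le_integral => //.
      - by move=> x _; rewrite lee_fin.
      - exact/measurable_EFinP.
      - by under eq_fun do rewrite -EFinM; apply/measurable_EFinP;
        exact: measurable_funM.
      - by move=> x _; rewrite -EFinM lee_fin /Pn ge_min lexx orbT.
    rewrite ge0_integralZl_EFin//; last 2 first.
    - by move=> x _; rewrite lee_fin ltW.
    - exact/measurable_EFinP.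
    apply: (@le_lt_trans _ _ (n%:R%:E * 1)%E); last by rewrite mule1 ltry.
    by rewrite lee_wpmul2l.
  have I0 : (0 <= \int[mu]_x (Pn n x)%:E)%E.
    by apply: integral_ge0 => x _; rewrite lee_fin.
  have fn : (\int[mu]_x (Pn n x)%:E)%E \is a fin_num by rewrite ge0_fin_numE.
  have := integral_test_le (mPn n) (Pn0 n) (esym (fineK fn)).
  move: I0; rewrite -(fineK fn); set N := fine _; rewrite !lee_fin => N0 NC.
  (* Here F^q0 = P^(1 - th) dominates [Pn ^ (1 - th)], so the test integral dominates that of [Pn].
     As N is finite, N^th can then be divided out, leaving N^(1 - th) <= C^q0. *)
  have {NC} NC : N <= C `^ q0 * N `^ th.
    rewrite -lee_fin (le_trans _ NC)// /N fineK//.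
    apply: ge0_le_integral => //.
    - by move=> x _; rewrite lee_fin.
    - exact/measurable_EFinP.
    - by apply/measurable_EFinP/measurable_funM; exact: measurable_fun_powR.
    move=> x _; rewrite lee_fin.
    have -> : F x `^ q0 = P x `^ (1 - th).
      by rewrite thE /P -powRrM mulrCA mulfV ?gt_eqF// mulr1.
    rewrite -[leLHS]powRr1// -[X in _ `^ X](subrK th) powRD; last first.
      by rewrite subrK oner_eq0.
    rewrite ler_wpM2r ?powR_ge0//; apply: ler_powR2r => //.
      exact: ltW.
    by rewrite /Pn ge_min lexx.
  have [->|NN0] := eqVneq N 0; first by rewrite powR_ge0.
  have {NN0} N_gt0 : 0 < N by rewrite lt_neqAle eq_sym NN0.
  have : N `^ (1 - th) <= C `^ q0.
    rewrite powRB; last by rewrite (gt_eqF N_gt0) implybT.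
    by rewrite powRr1// ler_pdivrMr// powR_gt0.
  have qq0 : 0 <= q / q0 by rewrite divr_ge0// ltW.
  move=> /(ler_powR2r qq0 (powR_ge0 _ _)).
  rewrite -!powRrM thE; have -> : q0 / q * (q / q0) = 1.
    by field; rewrite !gt_eqF.
  by have -> : q0 * (q / q0) = q; [field; rewrite gt_eqF | rewrite powRr1].
rewrite Lnorm_ge0E//.
suff : (\int[mu]_x (F x `^ q)%:E <= (C `^ q)%:E)%E.
  move=> /lee_poweR2r => /(_ q^-1); rewrite invr_ge0 ltW// => /(_ isT).
  rewrite poweR_EFin -powRrM mulfV ?gt_eqF// powRr1// => -> //.
  by apply: integral_ge0 => x _; rewrite lee_fin powR_ge0.
have -> : (\int[mu]_x (F x `^ q)%:E =
           \int[mu]_x limn (fun n => (Pn n x)%:E))%E.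
  apply: eq_integral => x _; apply/esym/lim_near_cst => //.
  near=> n; congr EFin; rewrite /Pn; apply/min_idPl.
  rewrite -ler_pdivrMr//; near: n; exact: nbhs_infty_ger.
rewrite monotone_convergence//.
- apply: lime_le; last by apply: nearW.
  apply: ereal_nondecreasing_is_cvgn => m n mn.
  apply: ge0_le_integral => //.
  + by move=> x _; rewrite lee_fin.
  + exact/measurable_EFinP.
  + exact/measurable_EFinP.
  + move=> x _; rewrite lee_fin /Pn le_min ge_min lexx/= ge_min.
    by rewrite ler_wpM2r ?orbT ?ler_nat// ltW.
- by move=> n; exact/measurable_EFinP.
- by move=> n x _; rewrite lee_fin.
- move=> x _ m n mn; rewrite lee_fin /Pn le_min ge_min lexx/= ge_min.
  by rewrite ler_wpM2r ?orbT ?ler_nat// ltW.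
Unshelve. all: by end_near. Qed.

(** Here th = 1. Testing with e restricted to E, the set where F > C, gives a nonpositive integral
    over E of (F^q0 - C^q0) e. This integrand is positive on E, so E is a null set. *)
Lemma Lnorm_le_duality_infty : dl = q0^-1 ->
  (Lnorm mu +oo%E (fun x => (F x)%:E) <= C%:E)%E.
Proof.
move=> dlE.
have [e [me e0 e1]] := sigma_finite_pos_integrable sfmu.
have e0' x : 0 <= e x by exact: ltW.
have thE : th = 1 by rewrite /th dlE mulVf ?gt_eqF.
pose E := F @^-1` `]C, +oo[.
have mE : measurable E by rewrite -[E]setTI; exact: mF.
have mFq : measurable_fun [set: Om] (fun x => F x `^ q0)
  by exact: measurable_fun_powR.
have FC x : E x -> C < F x by rewrite /E /= in_itv/= andbT.
have FCq x : E x -> C `^ q0 < F x `^ q0.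
  by move=> /FC CF; apply: gt0_ltr_powR => //; rewrite nnegrE.
pose h x := \1_E x * e x.
have mh : measurable_fun [set: Om] h.
  by apply: measurable_funM => //; exact: measurable_indic.
have h0 x : 0 <= h x by rewrite mulr_ge0.
have hE : (\int[mu]_x (h x)%:E = \int[mu]_(x in E) (e x)%:E)%E.
  rewrite [RHS]integral_mkcond; apply: eq_integral => x _.
  by rewrite patchE /h indicE; case: (x \in E); rewrite ?mul1r ?mul0r.
have I0 : (0 <= \int[mu]_(x in E) (e x)%:E)%E.
  by apply: integral_ge0 => x _; rewrite lee_fin.
have fn : (\int[mu]_(x in E) (e x)%:E)%E \is a fin_num.
  rewrite ge0_fin_numE// (@le_lt_trans _ _ 1%E) ?ltry//; apply: le_trans e1.
  apply: ge0_subset_integral => //; first exact/measurable_EFinP.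
  by move=> x _; rewrite lee_fin.
have := integral_test_le mh h0 (etrans hE (esym (fineK fn))).
rewrite thE powRr1 ?fine_ge0// EFinM fineK//.
have -> : (\int[mu]_x (F x `^ q0 * h x `^ 1)%:E =
           \int[mu]_(x in E) (F x `^ q0 * e x)%:E)%E.
  rewrite [RHS]integral_mkcond; apply: eq_integral => x _.
  rewrite patchE powRr1// /h indicE; case: (x \in E); rewrite ?mul1r//.
  by rewrite mul0r mulr0.
pose D x := (F x `^ q0 - C `^ q0) * e x.
have D0 x : E x -> 0 < D x by move=> /FCq ?; rewrite mulr_gt0// subr_gt0.
have mD : measurable_fun [set: Om] D.
  by apply: measurable_funM => //; exact: measurable_funB.
have -> : (\int[mu]_(x in E) (F x `^ q0 * e x)%:E =
           \int[mu]_(x in E) (D x)%:E + (C `^ q0)%:E * \int[mu]_(x in E) (e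
             x)%:E)%E.
  rewrite -ge0_integralZl_EFin ?powR_ge0//; last 2 first.
  - by move=> x _; rewrite lee_fin.
  - by apply/measurable_EFinP; exact: measurable_funS me.
  rewrite -ge0_integralD//.
  - by apply: eq_integral => x _; rewrite -EFinM -EFinD -mulrDl subrK.
  - by move=> x /D0/ltW; rewrite lee_fin.
  - by apply/measurable_EFinP; exact: measurable_funS mD.
  - by move=> x _; rewrite -EFinM lee_fin mulr_ge0 ?powR_ge0.
  - under eq_fun do rewrite -EFinM.
    by apply/measurable_EFinP/measurable_funM => //; exact: measurable_funS me.
(* The common term can be cancelled because e has finite integral over E. *)
rewrite -[leRHS]add0e leeD2rE; last by rewrite fin_numM.
move=> ID; have {}ID : (\int[mu]_(x in E) (D x)%:E = 0)%E.
  apply/eqP; rewrite eq_le ID; apply: integral_ge0 => x /D0/ltW.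
  by rewrite lee_fin.
have : (\int[mu]_(x in E) `|(D x)%:E| = 0)%E.
  rewrite -ID; apply: eq_integral => x /set_mem /D0/ltW Dx.
  by rewrite gee0_abs// lee_fin.
have mDE : measurable_fun E (fun x => (D x)%:E).
  by apply/measurable_EFinP; exact: measurable_funS mD.
move=> /(ae_eq_integral_abs mu mE mDE) DE0.
rewrite unlock; case: ifPn => // _; apply/ess_supP.
apply: filterS DE0 => x Dx /=; rewrite ger0_norm// lee_fin leNgt;
  apply/negP => Cx.
have Ex : E x by rewrite /E /= in_itv/= Cx.
by have := D0 _ Ex; have [->] := Dx Ex; rewrite ltxx.
Qed.

End NormTest.

(** A converse to [Lnorm_mul_powR_le]. It will be applied to weights of the form w h^dl with h >= k,
    which is why the test functions are strictly positive. *)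
Lemma Lnorm_le_duality
  (q0 dl C : R) (q : \bar R) (F : Om -> R) :
  sigma_finite [set: Om] mu -> 0 < q0 -> 0 < dl -> 0 <= C -> (0 < q)%E ->
  inv_e q = q0^-1 - dl ->
  measurable_fun [set: Om] F -> (forall x, 0 <= F x) ->
  (forall k : Om -> R, measurable_fun [set: Om] k -> (forall x, 0 < k x) ->
     (\int[mu]_x (k x)%:E <= 1)%E ->
     (Lnorm mu q0%:E (fun x => (F x * k x `^ dl)%:E) <= C%:E)%E) ->
  (Lnorm mu q (fun x => (F x)%:E) <= C%:E)%E.
Proof.
move=> sfmu q0_gt0 dl_gt0 C0 q_gt0 qE mF F0 HF.
have HF' (k : Om -> R) : measurable_fun [set: Om] k -> (forall x, 0 < k x) ->
    (\int[mu]_x (k x)%:E <= 1)%E ->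
    (\int[mu]_x (F x `^ q0 * k x `^ (dl * q0))%:E <= (C `^ q0)%:E)%E.
  move=> mk k0 Ik; have Fk0 x : 0 <= F x * k x `^ dl
    by rewrite mulr_ge0 ?powR_ge0.
  have /(Lnorm_leP mu q0_gt0 C0 Fk0) := HF k mk k0 Ik.
  congr (_ <= _)%E; apply: eq_integral => x _; congr EFin.
  by rewrite (powRM _ (F0 x) (powR_ge0 _ _)) -powRrM.
case: q q_gt0 qE => [q|_|//] /=; last first.
  move=> /esym/eqP; rewrite subr_eq0 => /eqP dlE.
  exact: (Lnorm_le_duality_infty sfmu q0_gt0 dl_gt0 C0 mF F0 HF').
rewrite lte_fin => q_gt0 qE.
exact: (Lnorm_le_duality_fin sfmu q0_gt0 dl_gt0 C0 mF F0 HF').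
Qed.

End Duality.

(** * The maximal operator and the Rubio de Francia algorithm *)

Section Maxop.
Context {R : realType} {d : measure_display} {Om : measurableType d}.
Variables (mu : {measure set Om -> \bar R}) (U : nat -> set Om).
Hypothesis HU : is_basis mu U.

Lemma basis_measurable i : measurable (U i).
Proof. by case: HU => + _ => /(_ i) []. Qed.

Lemma basis_fine i :
  mu (U i) = (fine (mu (U i)))%:E /\ 0 < fine (mu (U i)).
Proof.
case: HU => + _ => /(_ i) [_ [m0 moo]]; split.
  by rewrite fineK// ge0_fin_numE// ltW.
by rewrite fine_gt0// m0.
Qed.

Lemma average_le_maxop (f : Om -> R) i x : (forall y, 0 <= f y) -> U i x ->
  (((fine (mu (U i)))^-1)%:E * \int[mu]_(y in U i) (f y)%:E
   <= maxop mu U f x)%E.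
Proof.
move=> f0 Ux; apply: ereal_sup_ubound; exists i => //.
rewrite indicE mem_set// mule1 Lnorm_indic// invr1 poweRe1; last first.
  by apply: integral_ge0 => y _; rewrite lee_fin powR_ge0.
by congr (_ * _)%E; apply: eq_integral => y _; rewrite powRr1.
Qed.

Lemma maxop_ge0 (f : Om -> R) x : (0 <= maxop mu U f x)%E.
Proof.
apply: le_trans (ereal_sup_ubound (ex_intro2 _ _ 0%N Logic.I erefl)).
by rewrite !mule_ge0 ?Lnorm_ge0// lee_fin ?invr_ge0 ?fine_ge0.
Qed.

Lemma measurable_maxop (f : Om -> R) : measurable_fun [set: Om] (maxop mu U f).
Proof.
pose u i x := (((fine (mu (U i)))^-1)%:E * Lnorm mu 1 (fun y =>
  (\1_(U i) y * f y)%:E)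
    * (\1_(U i) x)%:E)%E : \bar R.
have mu_ i : measurable_fun [set: Om] (u i).
  apply: measurable_funeM; apply/measurable_EFinP/measurable_indic.
  exact: basis_measurable.
rewrite (_ : maxop _ _ _ = fun x => esups (u ^~ x) 0).
  exact: measurable_fun_esups.
apply/funext => x; rewrite /maxop /esups /=; congr ereal_sup.
by apply/seteqP; split => [_ [i _ <-]|_ [i _ <-]]; exists i.
Qed.

Section RubioDeFrancia.
Variables (t kappa B : R) (v g0 : Om -> R).
Hypotheses (t1 : 1 < t) (k1 : 1 < kappa) (B0 : 0 < B).
Hypotheses (mv : measurable_fun [set: Om] v) (v0 : forall x, 0 < v x).
Hypothesis HM : forall f : Om -> R, measurable_fun [set: Om] f ->
  (Lnorm mu t%:E (fun x => (f x * v x)%:E) <= 1)%E ->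
  (Lnorm mu t%:E (fun x => maxop mu U f x * (v x)%:E)%E <= B%:E)%E.
Hypotheses (mg0 : measurable_fun [set: Om] g0) (g00 : forall x, 0 < g0 x).
Hypothesis g0v : (Lnorm mu t%:E (fun x => (g0 x * v x)%:E) <= 1)%E.

Let t0 : 0 < t. Proof. exact: lt_trans t1. Qed.
Let B0' : 0 <= B. Proof. exact: ltW. Qed.
Let v0' x : 0 <= v x. Proof. exact: ltW. Qed.
Let k0 : 0 < kappa. Proof. exact: lt_trans k1. Qed.

(** Normalized iterates of the maximal operator. Where a maximal function is infinite, [fine]
    returns 0; by [maxop_fin] this happens only on a null set, and it can only decrease the norm. *)
Let it n := iter n (fun f x => B^-1 * fine (maxop mu U f x)) g0.

Let it_ge0 n x : 0 <= it n x.
Proof.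
case: n => [|n]; first exact: ltW.
by rewrite /it iterS mulr_ge0 ?invr_ge0 ?fine_ge0 ?maxop_ge0// ltW.
Qed.

Let mit n : measurable_fun [set: Om] (it n).
Proof.
case: n => // n; rewrite /it iterS; apply: measurable_funM => //.
by apply: measurableT_comp => //; exact: measurable_maxop.
Qed.

Let maxop_powR (f : Om -> R) : measurable_fun [set: Om] f ->
  (Lnorm mu t%:E (fun x => (f x * v x)%:E) <= 1)%E ->
  (\int[mu]_x (maxop mu U f x * (v x)%:E) `^ t <= (B `^ t)%:E)%E.
Proof.
move=> mf /(HM mf); rewrite unlock => /(lee_poweR2r (ltW t0)) H.
have := H (poweR_ge0 _ _); rewrite -poweRrM mulVf ?gt_eqF// poweRe1; last first.
  by apply: integral_ge0 => x _; exact: poweR_ge0.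
apply: le_trans; rewrite le_eqVlt; apply/orP; left; apply/eqP.
by apply: eq_integral => x _; rewrite gee0_abs// mule_ge0 ?maxop_ge0// lee_fin.
Qed.

Let mmaxop_powR (f : Om -> R) :
  measurable_fun [set: Om] (fun x => (maxop mu U f x * (v x)%:E) `^ t)%E.
Proof.
apply: (@measurableT_comp _ _ _ _ _ _ (fun y : \bar R => (y `^ t)%E)).
  exact: measurable_poweR.
by apply: emeasurable_funM; [exact: measurable_maxop|exact/measurable_EFinP].
Qed.

Let it_norm n : (Lnorm mu t%:E (fun x => (it n x * v x)%:E) <= 1)%E.
Proof.
elim: n => // n ih; apply/Lnorm_leP => //.
  by move=> x; rewrite mulr_ge0.
rewrite powR1.
apply: (@le_trans _ _ (\int[mu]_x ((B^-1 `^ t)%:E *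
    (maxop mu U (it n) x * (v x)%:E) `^ t)%E)%E).
  apply: ge0_le_integral => //.
  - by move=> x _; rewrite lee_fin powR_ge0.
  - apply/measurable_EFinP/measurable_fun_powR/measurable_funM => //.
  - apply: measurable_funeM; exact: mmaxop_powR.
  - move=> x _; rewrite /it iterS -/(it n) -mulrA powRM ?invr_ge0//; last first.
      by rewrite mulr_ge0// fine_ge0// maxop_ge0.
    rewrite EFinM lee_wpmul2l ?lee_fin ?powR_ge0// -poweR_EFin.
    have := maxop_ge0 (it n) x; case: (maxop mu U (it n) x) => [y|_|//] /=.
      by rewrite lexx.
    by rewrite mul0r powR0 ?gt_eqF// poweR_ge0.
rewrite ge0_integralZl_EFin ?powR_ge0//; last first.
  by move=> x _; exact: poweR_ge0.
apply: (@le_trans _ _ ((B^-1 `^ t)%:E * (B `^ t)%:E)%E).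
  by rewrite lee_wpmul2l ?lee_fin ?powR_ge0// maxop_powR.
by rewrite -EFinM -powRM ?invr_ge0// mulVf ?gt_eqF// powR1.
Qed.

Let maxop_fin : {ae mu, forall x, forall n, maxop mu U (it n) x \is a fin_num}.
Proof.
apply/ae_foralln => n.
have I : mu.-integrable [set: Om] (fun x =>
  (maxop mu U (it n) x * (v x)%:E) `^ t)%E.
  apply/integrableP; split; first exact: mmaxop_powR.
  under eq_integral do rewrite gee0_abs ?poweR_ge0//.
  by rewrite (le_lt_trans (maxop_powR (mit n) (it_norm n)))// ltry.
have := integrable_ae measurableT I.
apply: filterS => x /(_ Logic.I).
have := maxop_ge0 (it n) x; case: (maxop mu U (it n) x) => //= _.
by rewrite gt0_mulye ?lte_fin// /poweR gt_eqF.
Qed.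

(** The ratio is 1/kappa', so the a^j sum to 1/(1 - a) = kappa, the norm bound, while shifting the
    series by one index costs the factor 1/a = kappa' of the A_1 constant. *)
Let a := (kappa - 1) / kappa.
Let a0 : 0 < a. Proof. by rewrite divr_gt0// subr_gt0. Qed.
Let a0' n : 0 <= a ^+ n. Proof. by rewrite exprn_ge0// ltW. Qed.

Let Sn n x := \sum_(j < n) a ^+ j * it j x.

Let Sn_ge0 n x : 0 <= Sn n x.
Proof. by apply: sumr_ge0 => j _; rewrite mulr_ge0. Qed.

Let SnS n x : Sn n.+1 x = Sn n x + a ^+ n * it n x.
Proof. by rewrite /Sn big_ord_recr. Qed.

Let mSn n : measurable_fun [set: Om] (Sn n).
Proof.
apply: measurable_sum => j; apply: measurable_funM => //.
Qed.

Let ndSn m n x : (m <= n)%N -> Sn m x <= Sn n x.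
Proof.
move=> /subnK <-; elim: (n - m)%N => // k ih.
by rewrite addSn SnS (le_trans ih)// lerDl mulr_ge0.
Qed.

(** Minkowski's inequality; the right-hand side is the geometric sum of the a^j with j < n. *)
Let Sn_norm n : (Lnorm mu t%:E (fun x => (Sn n x * v x)%:E)
                 <= (kappa * (1 - a ^+ n))%:E)%E.
Proof.
elim: n => [|n ih].
  rewrite expr0 subrr mulr0 (_ : (fun _ => _) = cst 0%E) ?Lnorm0//.
    by rewrite eqe gt_eqF.
  by apply/funext => x; rewrite /Sn big_ord0 mul0r.
rewrite (_ : (fun x => _) =
  (EFin \o ((fun x => Sn n x * v x) \+ (fun x =>
    a ^+ n * (it n x * v x)))%R)); last first.
  by apply/funext => x /=; rewrite SnS mulrDl mulrA.
have mit' : measurable_fun [set: Om] (fun x => it n x * v x).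
  exact: measurable_funM.
apply: (le_trans (minkowski_EFin _ _ _ _)); rewrite ?(ltW t1)//.
- exact: measurable_funM.
- exact: measurable_funM.
have /= -> := @Lnorm_Zge0 _ _ _ mu _ _ _ t0 (a0' n) mit' (fun x =>
  mulr_ge0 (it_ge0 n x) (v0' x)).
rewrite (_ : kappa * _ = kappa * (1 - a ^+ n) + a ^+ n); last first.
  by rewrite exprS /a; field; rewrite gt_eqF.
rewrite EFinD leeD//.
by rewrite -[leRHS]mule1 lee_wpmul2l ?lee_fin ?it_norm.
Qed.

Let G x := (\sum_(j <oo) (a ^+ j * it j x)%:E)%E.

Let Gterm0 j x : (0 <= (a ^+ j * it j x)%:E)%E.
Proof. by rewrite lee_fin mulr_ge0. Qed.

Let SnG n x : ((Sn n x)%:E <= G x)%E.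
Proof.
rewrite /Sn -sumEFin.
by rewrite -(big_mkord xpredT (fun j => (a ^+ j * it j x)%:E)) nneseries_lim_ge.
Qed.

Let G_le x y : (forall n, (Sn n x)%:E <= y)%E -> (G x <= y)%E.
Proof.
move=> H; apply: lime_le; first exact: is_cvg_nneseries.
by apply: nearW => n; rewrite big_mkord sumEFin; exact: H.
Qed.

Let mG : measurable_fun [set: Om] G.
Proof.
apply: ge0_emeasurable_sum => // n _;
  apply/measurable_EFinP/measurable_funM => //.
Qed.

(** This stands for (G v)^t. As a monotone limit it inherits the bound of [Sn_norm] by monotone
    convergence, and where it is finite, so is G. *)
Let H x := limn (fun n => ((Sn n x * v x) `^ t)%:E).

Let Hnd x : nondecreasing_seq (fun n => ((Sn n x * v x) `^ t)%:E).
Proof.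
move=> m n mn; rewrite lee_fin; apply: ler_powR2r; rewrite ?mulr_ge0//.
  exact: ltW.
by rewrite ler_wpM2r// ndSn.
Qed.

Let H_ge n x : (((Sn n x * v x) `^ t)%:E <= H x)%E.
Proof.
rewrite /H (cvg_lim _ (ereal_nondecreasing_cvgn (Hnd x)))//.
by apply: ereal_sup_ubound; exists n.
Qed.

Let H_int : (\int[mu]_x H x <= (kappa `^ t)%:E)%E.
Proof.
have mh n : measurable_fun [set: Om] (fun x => ((Sn n x * v x) `^ t)%:E).
  apply/measurable_EFinP/measurable_fun_powR/measurable_funM => //.
have h0 n x : (0 <= ((Sn n x * v x) `^ t)%:E)%E by rewrite lee_fin powR_ge0.
rewrite monotone_convergence//.
apply: lime_le.
  apply: ereal_nondecreasing_is_cvgn => m n mn.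
  by apply: ge0_le_integral => // x _; exact: Hnd.
apply: nearW => n; apply/Lnorm_leP => //; first exact: ltW.
  by move=> x; rewrite mulr_ge0.
apply: (le_trans (Sn_norm n)); rewrite lee_fin ger_pMr// gerBl.
exact: a0'.
Qed.

Let mH : measurable_fun [set: Om] H.
Proof.
have -> : H = fun x => esups (fun n => ((Sn n x * v x) `^ t)%:E) 0.
  apply/funext => x.
  rewrite /H (cvg_lim _ (ereal_nondecreasing_cvgn (Hnd x)))// /esups /=.
  congr ereal_sup.
  by apply/seteqP; split => [_ [i _ <-]|_ [i _ <-]]; exists i.
apply: measurable_fun_esups => n.
apply/measurable_EFinP/measurable_fun_powR/measurable_funM => //.
Qed.

Let G_H x : H x \is a fin_num -> (G x <= ((fine (H x)) `^ t^-1 / v x)%:E)%E.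
Proof.
move=> fH; apply: G_le => n; rewrite lee_fin ler_pdivlMr//.
have SV : 0 <= Sn n x * v x by rewrite mulr_ge0.
rewrite -[leLHS](powRr1 SV) -(@mulfV _ t) ?gt_eqF// powRrM.
apply: ler_powR2r; rewrite ?invr_ge0 ?powR_ge0//; first exact: ltW.
by rewrite -lee_fin fineK.
Qed.

Let H_fin : {ae mu, forall x, H x \is a fin_num}.
Proof.
have H0 x : (0 <= H x)%E
  by apply: le_trans (H_ge 0 x); rewrite lee_fin powR_ge0.
have I : mu.-integrable [set: Om] H.
  apply/integrableP; split; first exact: mH.
  under eq_integral do rewrite gee0_abs//.
  by rewrite (le_lt_trans H_int)// ltry.
by apply: filterS (integrable_ae measurableT I) => x; exact.
Qed.

Let g x := Num.max (g0 x) (fine (G x)).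

Let gG x : H x \is a fin_num -> (g x)%:E = G x.
Proof.
move=> /G_H GH.
have G0 : (0 <= G x)%E by exact: nneseries_ge0.
have fG : G x \is a fin_num by rewrite ge0_fin_numE// (le_lt_trans GH) ?ltry.
rewrite /g max_r ?fineK// -lee_fin fineK//.
by apply: le_trans (SnG 1 x); rewrite /Sn big_ord1 expr0 mul1r.
Qed.

(* The partial sums of [a ^+ j * it j] converge in L^t_v; dividing each iterate
   by [B] keeps it in the unit ball, so no homogeneity of [maxop] is needed. The
   maximum with [g0] only matters on the null set where the series diverges and
   [fine] returns 0; it keeps [g] positive there. *)
Lemma rubio_de_francia : exists g : Om -> R,
  [/\ measurable_fun [set: Om] g, forall x, g0 x <= g x,
      (\int[mu]_x ((g x * v x) `^ t)%:E <= (kappa `^ t)%:E)%E &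
      forall i, {ae mu, forall x, U i x ->
        (((fine (mu (U i)))^-1)%:E * \int[mu]_(y in U i) (g y)%:E
         <= (kappa / (kappa - 1) * B * g x)%:E)%E}].
Proof.
have mg : measurable_fun [set: Om] g.
  by apply: measurable_maxr => //; exact: measurableT_comp.
have g0g x : g0 x <= g x by rewrite le_max lexx.
have gp x : 0 <= g x by rewrite (le_trans _ (g0g x))// ltW.
exists g; split => //.
- apply: le_trans H_int; apply: ge0_le_integral => //.
  + by move=> x _; rewrite lee_fin powR_ge0.
  + by apply/measurable_EFinP/measurable_fun_powR/measurable_funM.
  move=> x _.
  have H0 : (0 <= H x)%E
    by apply: le_trans (H_ge 0 x); rewrite lee_fin powR_ge0.
  have [->|HN] := eqVneq (H x) +oo%E; first by rewrite leey.
  have fH : H x \is a fin_num by rewrite ge0_fin_numE// ltey.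
  rewrite -(fineK fH) lee_fin.
  have : ((g x)%:E <= (fine (H x) `^ t^-1 / v x)%:E)%E by rewrite gG// G_H.
  rewrite lee_fin ler_pdivlMr// => gv.
  rewrite -[leRHS]powRr1 ?fine_ge0// -(@mulVf _ t) ?gt_eqF// powRrM.
  by apply: ler_powR2r; rewrite ?mulr_ge0// ltW.
move=> i; have mUi := basis_measurable i.
(* Almost everywhere g agrees with the series G, which can be integrated term by term. *)
have intE : (\int[mu]_(y in U i) (g y)%:E
           = \sum_(j <oo) \int[mu]_(y in U i) (a ^+ j * it j y)%:E)%E.
  rewrite -integral_nneseries//; last first.
    move=> n; apply/measurable_EFinP/measurable_funM => //.
    exact: measurable_funS (mit n).
  apply: ge0_ae_eq_integral => //.
  - by apply/measurable_EFinP; exact: measurable_funS mg.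
  - exact: measurable_funS mG.
  - by move=> x _; rewrite lee_fin.
  - by move=> x _; exact: nneseries_ge0.
  - by apply: filterS H_fin => x /gG gGx _; exact: gGx.
have [_ m0] := basis_fine i; have m0' := ltW m0.
apply: filterS2 maxop_fin H_fin => x Mx /gG gGx Ux.
rewrite EFinM gGx intE -nneseriesZl; last first.
  by move=> j _; apply: integral_ge0.
(* The average of a^j [it j] is at most a^j M([it j]) = a^j B [it j.+1] = kappa' B a^(j+1)
   [it j.+1]. The shifted series is G without its first term. *)
apply: (@le_trans _ _ (\sum_(j <oo) ((kappa / (kappa - 1) * B)%:E *
                          (a ^+ j.+1 * it j.+1 x)%:E))%E).
  apply: lee_nneseries => [j _ _|j _].
    by rewrite mule_ge0 ?lee_fin ?invr_ge0//; exact: integral_ge0.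
  under eq_integral do rewrite EFinM.
  rewrite ge0_integralZl_EFin//; last 2 first.
  - by move=> y _; rewrite lee_fin.
  - by apply/measurable_EFinP; exact: measurable_funS (mit j).
  rewrite muleCA.
  have -> : ((kappa / (kappa - 1) * B)%:E * (a ^+ j.+1 * it j.+1 x)%:E
      = (a ^+ j)%:E * maxop mu U (it j) x)%E.
    rewrite -(fineK (Mx j)) -!EFinM; congr EFin.
    have -> : it j.+1 x = B^-1 * fine (maxop mu U (it j) x) by [].
    rewrite exprS /a; field.
    by rewrite !gt_eqF// subr_gt0.
  by rewrite lee_wpmul2l ?lee_fin// average_le_maxop.
have kB : 0 <= kappa / (kappa - 1) * B.
  by rewrite mulr_ge0 ?divr_ge0 ?subr_ge0// ltW.
rewrite nneseriesZl; last by move=> j _.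
rewrite lee_wpmul2l ?lee_fin//.
have -> : (G x = (a ^+ 0 * it 0 x)%:E
                 + \sum_(j <oo) (a ^+ j.+1 * it j.+1 x)%:E)%E.
  rewrite /G nneseries_recl// -(nneseries_addn 1)//; congr (_ + _)%E.
  by apply: eq_eseriesr => j _; rewrite addn1.
by rewrite leeDr.
Qed.

End RubioDeFrancia.
End Maxop.

(** * Finiteness of the integrals in the weight constant *)

Lemma char_ge0 (R : realType) (d : measure_display) (Om : measurableType d)
  (mu : {measure set Om -> \bar R}) (U : nat -> set Om) (s r : \bar R)
  (w v : Om -> R) : (0 <= char mu U s r w v)%E.
Proof.
apply: le_trans (ereal_sup_ubound (ex_intro2 _ _ 0%N Logic.I erefl)).
by rewrite !mule_ge0 ?Lnorm_ge0 ?lee_fin ?powR_ge0.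
Qed.

Section PositiveIntegral.
Context {R : realType} {d : measure_display} {Om : measurableType d}.
Variable mu : {measure set Om -> \bar R}.

Lemma integral_gt0_set (D : set Om) (f : Om -> R) :
  measurable D -> (0 < mu D)%E -> measurable_fun D f ->
  (forall x, 0 < f x) -> (0 < \int[mu]_(x in D) (f x)%:E)%E.
Proof.
move=> mD mu0 mf f0.
have I0 : (0 <= \int[mu]_(x in D) (f x)%:E)%E.
  by apply: integral_ge0 => x _; rewrite lee_fin ltW.
rewrite lt0e I0 andbT; apply/eqP => fI.
have : (\int[mu]_(x in D) `|(f x)%:E| = 0)%E.
  by rewrite -fI; apply: eq_integral => x _; rewrite gee0_abs// lee_fin ltW.
have mf' : measurable_fun D (fun x => (f x)%:E) by exact/measurable_EFinP.
move=> /(ae_eq_integral_abs mu mD mf') [N [mN N0 fN]].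
have : (mu D <= mu N)%E.
  apply: le_measure; rewrite ?inE// => x Dx; apply: fN => /= /(_ Dx) [] fx.
  by have := f0 x; rewrite fx ltxx.
by rewrite N0 leNgt mu0.
Qed.

End PositiveIntegral.

Section CharData.
Context {R : realType} {d : measure_display} {Om : measurableType d}.
Variables (mu : {measure set Om -> \bar R}) (U : nat -> set Om).
Hypothesis HU : is_basis mu U.
Variables (s r : R) (w : Om -> R).
Hypotheses (s_gt0 : 0 < s) (r_gt0 : 0 < r) (Hw : weight w).
Hypothesis Hwc : (char mu U s%:E r%:E w w < +oo)%E.

(** A finite product of positive factors has finite factors. Positivity has to come first, since 0
    times infinity is 0. Afterwards all exponent arithmetic takes place in the reals. *)
Lemma char_finite_data (K := fine (char mu U s%:E r%:E w w)) :
  exists W Y : nat -> R, [/\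
    (forall i, 0 < W i /\ (\int[mu]_(x in U i) (w x `^ s)%:E)%E = (W i)%:E),
    (forall i, 0 < Y i /\ (\int[mu]_(x in U i) ((w x)^-1 `^ r)%:E)%E = (Y
      i)%:E) &
    forall i, fine (mu (U i)) `^ (- (s^-1 + r^-1)) * W i `^ s^-1 * Y i `^ r^-1
              <= K].
Proof.
have [mw w0] := Hw.
have muU i : (0 < mu (U i))%E by case: HU => /(_ i) [_ []].
have mUi := basis_measurable HU.
have [W EW] : exists W, forall i, W i = (\int[mu]_(x in U i) (w x `^ s)%:E)%E.
  by eexists => i; reflexivity.
have [Y EY] : exists Y, forall i, Y i = (\int[mu]_(x in U i) ((w x)^-1 `^
  r)%:E)%E.
  by eexists => i; reflexivity.
have W_gt0 i : (0 < W i)%E.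
  rewrite EW; apply: integral_gt0_set => //; last by move=> x; exact: powR_gt0.
  by apply: measurable_fun_powR; exact: measurable_funS mw.
have Y_gt0 i : (0 < Y i)%E.
  rewrite EY; apply: integral_gt0_set => //;
    last by move=> x; rewrite powR_gt0// invr_gt0.
  apply: measurable_fun_powR; apply: measurable_fun_inv => //.
  exact: measurable_funS mw.
have term_le i : (((fine (mu (U i))) `^ (- (s^-1 + r^-1)))%:E
    * W i `^ s^-1 * Y i `^ r^-1 <= char mu U s%:E r%:E w w)%E.
  apply: ereal_sup_ubound; exists i => //.
  rewrite EW EY !Lnorm_indic// => x; rewrite ?invr_ge0; exact: ltW.
have m_gt0 i : 0 < fine (mu (U i)) by have [] := basis_fine HU i.
have Wp i : (0 < W i `^ s^-1)%E by exact: poweR_gt0.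
have Yp i : (0 < Y i `^ r^-1)%E by exact: poweR_gt0.
have ms i : (0 < ((fine (mu (U i))) `^ (- (s^-1 + r^-1)))%:E)%E.
  by rewrite lte_fin powR_gt0.
have Wf i : W i \is a fin_num.
  rewrite ge0_fin_numE; last exact: ltW.
  rewrite ltNge leye_eq; apply/negP => /eqP E.
  have := le_lt_trans (term_le i) Hwc.
  by rewrite E poweRyr ?invr_eq0 ?gt_eqF// gt0_muley// gt0_mulye// ltxx.
have Yf i : Y i \is a fin_num.
  rewrite ge0_fin_numE; last exact: ltW.
  rewrite ltNge leye_eq; apply/negP => /eqP E.
  have := le_lt_trans (term_le i) Hwc.
  rewrite E poweRyr ?invr_eq0 ?gt_eqF// gt0_muley ?ltxx//.
  exact: mule_gt0.
exists (fun i => fine (W i)), (fun i => fine (Y i)); split => i.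
- by rewrite -lte_fin -EW fineK.
- by rewrite -lte_fin -EY fineK.
have := term_le i; rewrite -{1}(fineK (Wf i)) -{1}(fineK (Yf i)).
rewrite !poweR_EFin -!EFinM => H.
rewrite -lee_fin /K fineK// ge0_fin_numE//.
by apply: le_trans H; rewrite lee_fin !mulr_ge0 ?powR_ge0.
Qed.

End CharData.

(** * The constants of the dual power v and of the twisted weight *)

Section Weights.
Context {R : realType} {d : measure_display} {Om : measurableType d}.
Variables (mu : {measure set Om -> \bar R}) (U : nat -> set Om).
Hypothesis HU : is_basis mu U.
Variables (s r : R) (w : Om -> R).
Hypotheses (s_gt0 : 0 < s) (r_gt0 : 0 < r) (Hw : weight w).
(* The finite values of the integrals of w^s and w^-r and of mu on U i, and the
   constant [w]_(s,r); see [char_finite_data]. *)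
Variables (W Y m : nat -> R) (K : R).
Hypothesis m_fine : forall i, fine (mu (U i)) = m i.
Hypothesis HW : forall i,
  0 < W i /\ (\int[mu]_(x in U i) (w x `^ s)%:E)%E = (W i)%:E.
Hypothesis HY : forall i,
  0 < Y i /\ (\int[mu]_(x in U i) ((w x)^-1 `^ r)%:E)%E = (Y i)%:E.
Hypothesis HK : forall i,
  m i `^ (- (s^-1 + r^-1)) * W i `^ s^-1 * Y i `^ r^-1 <= K.

Let w0 x : 0 < w x. Proof. by case: Hw => _; exact. Qed.
Let w0' x : 0 <= w x. Proof. exact: ltW. Qed.
Let mw : measurable_fun [set: Om] w. Proof. by case: Hw. Qed.
Let sr0 : 0 < s^-1 + r^-1. Proof. by rewrite addr_gt0// invr_gt0. Qed.
Let sr0' : 0 <= s^-1 + r^-1. Proof. exact: ltW. Qed.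
Let r_ge0 : 0 <= r. Proof. exact: ltW. Qed.
Let mUi := basis_measurable HU.
Let m_gt0 i : 0 < m i.
Proof. by rewrite -m_fine; have [] := basis_fine HU i. Qed.
Let m_ge0 i : 0 <= m i. Proof. exact: ltW. Qed.
Let muU i : (0 < mu (U i))%E. Proof. by case: HU => /(_ i) [_ []]. Qed.
Let W_gt0 i : 0 < W i. Proof. by case: (HW i). Qed.
Let Y_gt0 i : 0 < Y i. Proof. by case: (HY i). Qed.
Let Y_ge0 i : 0 <= Y i. Proof. exact: ltW. Qed.
Let WE i : (\int[mu]_(x in U i) (w x `^ s)%:E)%E = (W i)%:E.
Proof. by case: (HW i). Qed.
Let YE i : (\int[mu]_(x in U i) ((w x)^-1 `^ r)%:E)%E = (Y i)%:E.
Proof. by case: (HY i). Qed.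
Let X_ge0 i : 0 <= m i `^ (- (s^-1 + r^-1)) * W i `^ s^-1 * Y i `^ r^-1.
Proof. by rewrite !mulr_ge0// powR_ge0. Qed.

Let sg := s^-1 + r^-1.
Let t := sg * r.
Let v x := w x `^ (- sg^-1).

(** Since v^t = w^(-r) and v^(-t') = w^s with t' = s sg, the two integrals of w exchange their
    places. As 1/t + 1/t' = 1, each term of [v]_t is the power 1/sg of the corresponding term of
    [w]_(s,r). *)
Lemma char_dual_power_le :
  (char mu U t%:E (hconj t%:E) v v <= (K `^ sg^-1)%:E)%E /\
  fine (hconj t%:E) = s * sg.
Proof.
have sgN : sg != 0 by rewrite gt_eqF.
have sN : s != 0 by rewrite gt_eqF.
have rN : r != 0 by rewrite gt_eqF.
have t0 : 0 < t by rewrite mulr_gt0.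
have tE : t = r / s + 1 by rewrite /t /sg mulrDl mulVf// mulrC.
have t1 : t - 1 = r / s by rewrite tE addrK.
have tN1 : t == 1 = false.
  by apply/negbTE; rewrite -subr_eq0 t1 mulf_neq0 ?invr_eq0.
have hE : hconj t%:E = (s * sg)%:E.
  by rewrite /hconj tN1 t1 /t; congr EFin; field; rewrite sN rN.
have ss0 : 0 < s * sg by rewrite mulr_gt0.
rewrite hE; split => //.
apply: ge_ereal_sup => _ [i _ <-]; rewrite !Lnorm_indic//; last 2 first.
- by move=> x; rewrite invr_ge0 powR_ge0.
- by move=> x; exact: powR_ge0.
have -> : (\int[mu]_(x in U i) (v x `^ t)%:E = (Y i)%:E)%E.
  rewrite -YE; apply: eq_integral => x _; congr EFin.
  rewrite -(powR_inv1 (w0' x)) /v -!powRrM; congr (_ `^ _).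
  by rewrite /t; field.
have -> : (\int[mu]_(x in U i) ((v x)^-1 `^ (s * sg))%:E = (W i)%:E)%E.
  rewrite -WE; apply: eq_integral => x _; congr EFin.
  rewrite /v -powRN opprK -!powRrM; congr (_ `^ _).
  by field.
rewrite !poweR_EFin -!EFinM lee_fin m_fine.
apply: le_trans (ler_powR2r _ (X_ge0 i) (HK i)); last by rewrite invr_ge0.
rewrite !powRM ?powR_ge0// ?mulr_ge0 ?powR_ge0// -!powRrM mulrAC.
rewrite /inv_e -/sg.
have -> : - (t^-1 + (s * sg)^-1) = - sg / sg.
  have -> : t^-1 + (s * sg)^-1 = (s^-1 + r^-1) / sg.
    by rewrite /t; field; rewrite sN rN sgN.
  by rewrite mulNr.
by rewrite /t !invfM [sg^-1 * _]mulrC.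
Qed.

Section TwistedWeight.
Variables (s0 dl : R) (r0 : \bar R) (A : R) (g : Om -> R).
Hypotheses (s0_gt0 : 0 < s0) (r0_gt0 : (0 < r0)%E) (dl_gt0 : 0 < dl).
Hypotheses (s0E : s0^-1 = s^-1 + dl) (r0E : inv_e r0 = r^-1 - dl).
Hypotheses (A_gt0 : 0 < A) (mg : measurable_fun [set: Om] g).
Hypothesis g_gt0 : forall x, 0 < g x.
Hypothesis gA : forall i, {ae mu, forall x, U i x ->
  (((m i)^-1)%:E * \int[mu]_(y in U i) (g y)%:E <= (A * g x)%:E)%E}.

Let be := t * dl.
Let rho := 1 - r * dl.
Let g_ge0 x : 0 <= g x. Proof. exact: ltW. Qed.
Let be_gt0 : 0 < be. Proof. by rewrite !mulr_gt0. Qed.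
Let be_ge0 : 0 <= be. Proof. exact: ltW. Qed.
Let sN : s != 0. Proof. by rewrite gt_eqF. Qed.
Let rN : r != 0. Proof. by rewrite gt_eqF. Qed.
Let s0N : s0 != 0. Proof. by rewrite gt_eqF. Qed.
Let sgN : sg != 0. Proof. by rewrite gt_eqF. Qed.

(** So rho = r/r0, which vanishes exactly when r0 is infinite. *)
Let rhoE : rho = r * inv_e r0.
Proof. by rewrite r0E /rho mulrBr mulfV. Qed.

Let rho_ge0 : 0 <= rho.
Proof.
rewrite rhoE mulr_ge0//; case: r0 r0_gt0 => //= a.
by rewrite lte_fin => /ltW; rewrite invr_ge0.
Qed.

Let sg_s0 : s0^-1 + inv_e r0 = sg.
Proof. by rewrite s0E r0E /sg addrA addrAC; ring. Qed.

(** This shows be s0 <= 1, so that it can serve as an interpolation exponent, and that the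
    complementary power of w^s is w^(rho s0). *)
Let theta : 1 - be * s0 = s0 * rho / s.
Proof.
have -> : 1 - be * s0 = s0 * (s0^-1 - be) by rewrite mulrBr mulfV// mulrC.
rewrite s0E /rho /be /t /sg; field; rewrite rN sN//.
Qed.

Let u x := w x * ((g x * v x) `^ t) `^ dl.

Let uE x : u x = g x `^ be * w x `^ rho.
Proof.
rewrite /u -powRrM -/be powRM ?powR_ge0// mulrCA; congr (_ * _).
rewrite /v -powRrM -{1}[w x]powRr1// -powRD; last first.
  by rewrite (gt_eqF (w0 x)) implybT.
by congr (_ `^ _); rewrite /rho /be /t; field.
Qed.

Let u_gt0 x : 0 < u x.
Proof. by rewrite uE mulr_gt0// powR_gt0. Qed.

Lemma weight_twisted : weight u.
Proof.
split=> [|x]; last exact: u_gt0.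
rewrite (_ : u = fun x => g x `^ be * w x `^ rho);
  last by apply/funext => x; rewrite uE.
by apply: measurable_funM; exact: measurable_fun_powR.
Qed.

Let mu_u : measurable_fun [set: Om] u. Proof. by case: weight_twisted. Qed.

Let I i := (\int[mu]_(x in U i) (g x)%:E)%E.

Let I_gt0 i : (0 < I i)%E.
Proof.
by apply: integral_gt0_set => //; exact: measurable_funS mg.
Qed.

(** If the integral were infinite, the A_1 bound would fail at every point of [U i], a set of
    positive measure. *)
Let I_fin i : I i \is a fin_num.
Proof.
rewrite ge0_fin_numE ?ltW// ltNge leye_eq; apply/negP => /eqP Ioo.
have [N [mN N0 gN]] := gA i.
have : (mu (U i) <= mu N)%E.
  apply: le_measure; rewrite ?inE// => x Ux; apply: gN => /= /(_ Ux).
  by rewrite -/(I i) Ioo gt0_muley ?lte_fin ?invr_gt0// leye_eq.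
by rewrite N0 leNgt muU.
Qed.

Let IE i : I i = (fine (I i))%:E. Proof. by rewrite fineK. Qed.
Let fI i : 0 < fine (I i). Proof. by rewrite -lte_fin -IE. Qed.
Let fI' i : 0 <= fine (I i). Proof. exact: ltW. Qed.

(** Interpolation between g and w^s with exponent be s0, applied to u = g^be w^rho. *)
Let norm1 i : (Lnorm mu s0%:E (fun x => (\1_(U i) x * u x)%:E)
   <= (fine (I i) `^ be * W i `^ (rho / s))%:E)%E.
Proof.
rewrite Lnorm_indic//; last by move=> x; exact: ltW.
have bs : 0 <= be * s0 <= 1.
  rewrite mulr_ge0//=; last exact: ltW.
  by rewrite -subr_ge0 theta !mulr_ge0 ?invr_ge0// ltW.
have mws : measurable_fun [set: Om] (fun x => w x `^ s)
  by exact: measurable_fun_powR.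
have := integral_powR_interpolation mu (mUi i) mg mws g_ge0 (fun x =>
  powR_ge0 _ _) bs.
rewrite -/(I i) IE WE !poweR_EFin -EFinM.
have -> : (\int[mu]_(x in U i) (g x `^ (be * s0) * (w x `^ s) `^ (1 - be *
  s0))%:E
           = \int[mu]_(x in U i) (u x `^ s0)%:E)%E.
  apply: eq_integral => x _; congr EFin.
  rewrite uE (powRM _ (powR_ge0 _ _) (powR_ge0 _ _)) -!powRrM theta.
  by have -> : s * (s0 * rho / s) = rho * s0 by field.
move=> /lee_poweR2r => /(_ s0^-1); rewrite invr_ge0 (ltW s0_gt0) => /(_ isT).
have I0 : (0 <= \int[mu]_(x in U i) (u x `^ s0)%:E)%E.
  by apply: integral_ge0 => x _; rewrite lee_fin powR_ge0.
move=> /(_ I0) /le_trans; apply.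
rewrite poweR_EFin lee_fin powRM ?powR_ge0// -!powRrM theta mulfK//.
by have -> : s0 * rho / s / s0 = rho / s by field; rewrite sN.
Qed.

(** The A_1 bound, read as 1/g <= m A / (integral of g over [U i]) and raised to the power be >=
    0. *)
Let inv_le i : {ae mu, forall x, U i x ->
  (u x)^-1 <= (m i * A / fine (I i)) `^ be * ((w x)^-1) `^ rho}.
Proof.
have J0 := fI i; have := IE i; move: J0; set J := fine (I i) => J0 EJ.
apply: filterS (gA i) => x H /H; rewrite -/(I i) EJ -EFinM lee_fin => gx.
rewrite uE invfM -!powRN -(powR_inv1 (w0' x)) -powRrM mulN1r.
rewrite ler_wpM2r ?powR_ge0// -mulN1r powRrM powR_inv1//.
apply: ler_powR2r; rewrite ?invr_ge0//.
rewrite -[leRHS]invrK lef_pV2 ?posrE ?invr_gt0//; last first.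
  by rewrite divr_gt0// mulr_gt0.
rewrite invf_div ler_pdivrMr ?mulr_gt0//.
move: gx; rewrite mulrC ler_pdivrMr// => /le_trans; apply.
by rewrite [A * _]mulrC -mulrA [A * _]mulrC.
Qed.

(** For finite r0 the bound [inv_le] is raised to the power r0, and rho r0 = r turns w^(-rho) into
    w^(-r). For r0 infinite, rho = 0 and [inv_le] is already a uniform bound. *)
Let norm2 i : (Lnorm mu r0 (fun x => (\1_(U i) x * (u x)^-1)%:E)
   <= ((m i * A / fine (I i)) `^ be * Y i `^ (rho / r))%:E)%E.
Proof.
set c := (m i * A / fine (I i)) `^ be.
have c0 : 0 <= c by exact: powR_ge0.
have u0 x : 0 <= (u x)^-1 by rewrite invr_ge0 ltW.
case: r0 r0_gt0 rhoE => [b|_|//] /=.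
- rewrite lte_fin => b0 rhob; have b0' := ltW b0.
  have bN : b != 0 by rewrite gt_eqF.
  rewrite Lnorm_indic//.
  have le : (\int[mu]_(x in U i) ((u x)^-1 `^ b)%:E <= (c `^ b * Y i)%:E)%E.
    rewrite EFinM -YE -ge0_integralZl_EFin ?powR_ge0//; last 2 first.
    - by move=> x _; rewrite lee_fin powR_ge0.
    - apply/measurable_EFinP/measurable_fun_powR/measurable_fun_inv => //.
      exact: measurable_funS mw.
    apply: ae_ge0_le_integral => //.
    - by move=> x _; rewrite lee_fin powR_ge0.
    - apply/measurable_EFinP/measurable_fun_powR/measurable_fun_inv => //.
      exact: measurable_funS mu_u.
    - by move=> x _; rewrite -EFinM lee_fin mulr_ge0 ?powR_ge0.
    - apply: measurable_funeM.
      apply/measurable_EFinP/measurable_fun_powR/measurable_fun_inv => //.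
      exact: measurable_funS mw.
    apply: filterS (inv_le i) => x H /H; rewrite -/c => {}H.
    rewrite -EFinM lee_fin.
    have -> : c `^ b * (w x)^-1 `^ r = (c * (w x)^-1 `^ rho) `^ b.
      rewrite powRM ?powR_ge0// -powRrM; congr (_ * _ `^ _).
      by rewrite rhob -mulrA mulVf// mulr1.
    by apply: ler_powR2r.
  move: le => /lee_poweR2r => /(_ b^-1); rewrite invr_ge0 b0' => /(_ isT).
  have I0 : (0 <= \int[mu]_(x in U i) ((u x)^-1 `^ b)%:E)%E.
    by apply: integral_ge0 => x _; rewrite lee_fin powR_ge0.
  move=> /(_ I0) /le_trans; apply.
  rewrite poweR_EFin powRM ?powR_ge0// -powRrM mulfV// powRr1//.
  by rewrite rhob mulrAC mulfV// mul1r.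
- rewrite mulr0 => rho0; rewrite rho0 mul0r powRr0 mulr1.
  rewrite unlock; case: ifPn => // _; apply/ess_supP.
  apply: filterS (inv_le i) => x H /=; rewrite lee_fin ger0_norm ?mulr_ge0//.
  rewrite indicE; case: (boolP (x \in U i)) => [/set_mem /H|_] /=.
    by rewrite rho0 powRr0 mulr1 mul1r.
  by rewrite mul0r.
Qed.

(** In the product of [norm1] and [norm2] the integrals of g cancel. Since be = sg (1 - rho), the
    remaining power of m is -sg rho, so what is left is A^be times the rho-th power of a term of
    [w]_(s,r). *)
Lemma char_twisted_le :
  (char mu U s0%:E r0 u u <= (A `^ be * K `^ rho)%:E)%E.
Proof.
apply: ge_ereal_sup => _ [i _ <-].
rewrite [inv_e s0%:E]/= sg_s0 m_fine.
apply: (@le_trans _ _ ((m i `^ - sg)%:E *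
   (fine (I i) `^ be * W i `^ (rho / s))%:E *
   ((m i * A / fine (I i)) `^ be * Y i `^ (rho / r))%:E)%E).
  apply: lee_pmul => //; rewrite ?mule_ge0 ?Lnorm_ge0 ?lee_fin ?powR_ge0//.
  by rewrite lee_wpmul2l ?lee_fin ?powR_ge0.
rewrite -!EFinM lee_fin.
apply: (@le_trans _ _ (A `^ be * (m i `^ (- sg) * W i `^ s^-1 * Y i `^ r^-1) `^
  rho)); last first.
  by rewrite ler_wpM2l ?powR_ge0//; apply: ler_powR2r.
have A0 := ltW A_gt0.
rewrite !powRM ?mulr_ge0 ?invr_ge0 ?powR_ge0// -!powRrM -/sg.
rewrite -(powR_inv1 (fI' i)) -!powRrM mulN1r [fine (I i) `^ - be]powRN.
have -> : - sg * rho = - sg + be by rewrite /rho /be /t; ring.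
rewrite powRD; last by rewrite (gt_eqF (m_gt0 i)) implybT.
rewrite [s^-1 * _]mulrC [r^-1 * _]mulrC le_eqVlt; apply/orP; left; apply/eqP.
by field; rewrite gt_eqF// powR_gt0.
Qed.

End TwistedWeight.

End Weights.

(** * Construction of the weight used for extrapolation *)

Section ExtrapolationWeight.
Context {R : realType} {d : measure_display} {Om : measurableType d}.
Variables (mu : {measure set Om -> \bar R}) (U : nat -> set Om).
Hypothesis HU : is_basis mu U.
Variables (s r s0 dl c : R) (r0 : \bar R) (w : Om -> R).
Hypotheses (s_gt0 : 0 < s) (r_gt0 : 0 < r) (Hw : weight w).
Hypothesis Hwc : (char mu U s%:E r%:E w w < +oo)%E.
Hypotheses (s0_gt0 : 0 < s0) (r0_gt0 : (0 < r0)%E) (dl_gt0 : 0 < dl).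
Hypotheses (s0E : s0^-1 = s^-1 + dl) (r0E : inv_e r0 = r^-1 - dl).
Hypothesis c1 : 1 <= c.
Let t := (s^-1 + r^-1) * r.
Hypothesis HM : forall v, weight v ->
  (Mnorm mu U t%:E v
   <= c%:E * char mu U t%:E (hconj t%:E) v v `^ fine (hconj t%:E))%E.

Lemma extrapolation_weight (kappa : R) (k : Om -> R) :
  1 < kappa -> measurable_fun [set: Om] k -> (forall x, 0 < k x) ->
  (\int[mu]_x (k x)%:E <= 1)%E ->
  exists h : Om -> R,
    [/\ measurable_fun [set: Om] h /\ (forall x, k x <= h x),
        (\int[mu]_x (h x)%:E <= (kappa `^ t)%:E)%E,
        weight (fun x => w x * h x `^ dl) &
        (char mu U s0%:E r0 (fun x => w x * h x `^ dl)%R (fun x =>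
          w x * h x `^ dl)%R
         <= ((kappa / (kappa - 1) * c) `^ (t * dl)
             * (fine (char mu U s%:E r%:E w w)) `^ (s / s0))%:E)%E].
Proof.
move=> k1 mk k0 Ik.
have [mw w0] := Hw.
have [W [Y [HW HY HK]]] := char_finite_data HU s_gt0 r_gt0 Hw Hwc.
set K := fine _ in HK *.
have K0 : 0 < K.
  apply: lt_le_trans (HK 0%N); have [W0 _] := HW 0%N; have [Y0 _] := HY 0%N.
  by have [_ m0] := basis_fine HU 0%N; rewrite !mulr_gt0// powR_gt0.
have K0' := ltW K0.
have sN : s != 0 by rewrite gt_eqF.
have rN : r != 0 by rewrite gt_eqF.
have s0N : s0 != 0 by rewrite gt_eqF.
pose sg := s^-1 + r^-1.
have sg0 : 0 < sg by rewrite addr_gt0// invr_gt0.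
have sgN : sg != 0 by rewrite gt_eqF.
have t1 : 1 < t by rewrite /t /sg mulrDl mulVf// ltrDr mulr_gt0 ?invr_gt0.
have t0 : 0 < t by exact: lt_trans t1.
have tN : t != 0 by rewrite gt_eqF.
pose v x := w x `^ (- sg^-1).
have v0 x : 0 < v x by rewrite powR_gt0.
have mv : measurable_fun [set: Om] v by exact: measurable_fun_powR.
have [Hv hE] := char_dual_power_le s_gt0 r_gt0 Hw (fun=> erefl) HW HY HK.
have c0 : 0 < c by exact: lt_le_trans c1.
(* The dual power satisfies [v]_t <= K^(1/sg) and t' = s sg, so [v]_t^t' <= K^s. *)
pose B := c * K `^ s.
have B0 : 0 < B by rewrite mulr_gt0// powR_gt0.
have HMv : (Mnorm mu U t%:E v <= B%:E)%E.
  apply: le_trans (HM (conj mv v0)) _.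
  rewrite /B [(c * _)%:E]EFinM lee_wpmul2l ?lee_fin ?(ltW c0)// hE.
  have ssg : 0 <= s * sg by rewrite mulr_ge0// ltW.
  apply: le_trans (lee_poweR2r ssg (char_ge0 _ _ _ _ _ _) Hv) _.
  rewrite poweR_EFin -powRrM -/sg.
  by have -> : sg^-1 * (s * sg) = s by field.
have HM' (f : Om -> R) : measurable_fun [set: Om] f ->
    (Lnorm mu t%:E (fun x => (f x * v x)%:E) <= 1)%E ->
    (Lnorm mu t%:E (fun x => maxop mu U f x * (v x)%:E)%E <= B%:E)%E.
  move=> mf f1; apply: le_trans HMv; apply: ereal_sup_ubound.
  by exists f.
(* Chosen so that (g0 v)^t = k: the integral bound on k puts g0 in the unit ball of L^t_v, and g >=
   g0 becomes h >= k. *)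
pose g0 x := k x `^ t^-1 / v x.
have g00 x : 0 < g0 x by rewrite divr_gt0// powR_gt0.
have mg0 : measurable_fun [set: Om] g0.
  apply: measurable_funM; first exact: measurable_fun_powR.
  exact: measurable_fun_inv.
have g0v x : (g0 x * v x) `^ t = k x.
  by rewrite /g0 divfK ?gt_eqF// -powRrM mulVf// powRr1// ltW.
have g0n : (Lnorm mu t%:E (fun x => (g0 x * v x)%:E) <= 1)%E.
  apply/Lnorm_leP => //; first by move=> x; rewrite mulr_ge0 ?ltW.
  by rewrite powR1; under eq_integral do rewrite g0v.
have [g [mg g0g Ig gA]] := rubio_de_francia HU t1 k1 B0 mv v0 HM' mg0 g00 g0n.
have g_gt0 x : 0 < g x by exact: lt_le_trans (g0g x).
have kk : 0 < kappa / (kappa - 1).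
  by rewrite divr_gt0 ?subr_gt0//; exact: lt_trans k1.
exists (fun x => (g x * v x) `^ t); split.
- split; first by apply: measurable_fun_powR; exact: measurable_funM.
  move=> x; rewrite -[leLHS]g0v; apply: ler_powR2r; rewrite ?(ltW t0)//.
    by rewrite mulr_ge0 ?ltW.
  by rewrite ler_wpM2r// ltW.
- exact: Ig.
- exact: weight_twisted.
have A0 : 0 < kappa / (kappa - 1) * B by rewrite mulr_gt0.
have := char_twisted_le HU s_gt0 r_gt0 Hw (fun=> erefl) HW HY HK
  s0_gt0 r0_gt0 dl_gt0 s0E r0E A0 mg g_gt0 gA.
move=> /le_trans; apply; rewrite lee_fin -/sg -/t /B.
have kk' := ltW kk; have c0' := ltW c0.
have kc0 : 0 <= kappa / (kappa - 1) * c by exact: mulr_ge0.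
rewrite mulrA (powRM _ kc0 (powR_ge0 _ _)) -mulrA ler_wpM2l ?powR_ge0//.
rewrite -powRrM -powRD; last by rewrite (gt_eqF K0) implybT.
(* The first summand comes from the factor K^s in the A_1 constant, the second from the rho-th power
   of K. As s t = s + r, they add up to 1 + s dl = s/s0. *)
have -> : s * (t * dl) + (1 - r * dl) = s / s0; last by [].
by rewrite s0E /t /sg; field; rewrite sN rN.
Qed.

End ExtrapolationWeight.

(** * Extrapolation of the bound on T *)

Theorem theorem1p1 (R : realType) (d : measure_display) (Om : measurableType d)
  (mu : {measure set Om -> \bar R}) (U : nat -> set Om)
  (Hsf : sigma_finite [set: Om] mu) (HU : is_basis mu U)
  (q0 p0 s0 s r : R) (r0 q p : \bar R)
  (Hq0 : 0 < q0) (Hp0 : 0 < p0) (Hs0 : 0 < s0) (Hs : 0 < s) (Hr : 0 < r)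
  (Hr0 : (0 < r0)%E) (Hq : (0 < q)%E) (Hp : (0 < p)%E)
  (He1 : inv_e q - q0^-1 = inv_e p - p0^-1)
  (He2 : inv_e p - p0^-1 = s^-1 - s0^-1)
  (He3 : s^-1 - s0^-1 = inv_e r0 - r^-1)
  (Hneg : inv_e r0 - r^-1 < 0)
  (w : Om -> R) (Hw : weight w) (Hwc : (char mu U s%:E r%:E w w < +oo)%E)
  (c : \bar R -> R)
  (Hc : forall t : \bar R, (1 < t)%E ->
     1 <= c t /\
     forall v : Om -> R, weight v ->
       (Mnorm mu U t v <= (c t)%:E * (char mu U t (hconj t) v v) `^ (fine (hconj t)))%E)
  (V : Type) (S : V -> Om -> R) (HS : forall f, measurable_fun [set: Om] (S f))
  (T : V -> Om -> R)
  (HTm : forall f, (exists w0, weight w0 /\ (char mu U s0%:E r0 w0 w0 < +oo)%E /\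
                               inLw mu p0%:E w0 (S f)) ->
                   measurable_fun [set: Om] (T f))
  (phi : R -> R) (Hphi : {homo phi : x y / x <= y})
  (HT : forall w0, weight w0 -> (char mu U s0%:E r0 w0 w0 < +oo)%E ->
     forall f, inLw mu p0%:E w0 (S f) ->
       (Lnorm mu q0%:E (fun x => (T f x * w0 x)%:E)
          <= (phi (fine (char mu U s0%:E r0 w0 w0)))%:E
             * Lnorm mu p0%:E (fun x => (S f x * w0 x)%:E))%E) :
  (forall f, inLw mu p w (S f) ->
     exists w0, weight w0 /\ (char mu U s0%:E r0 w0 w0 < +oo)%E /\
                inLw mu p0%:E w0 (S f)) /\
  (forall kappa : R, 1 < kappa ->
   forall f, inLw mu p w (S f) ->
     let t := (s^-1 + r^-1) / r^-1 in
     let beta := (s^-1 + r^-1) * (r^-1 - inv_e r0) / r^-1 in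
     (Lnorm mu q (fun x => (T f x * w x)%:E)
        <= (kappa `^ beta
            * phi (((kappa / (kappa - 1)) * c t%:E) `^ beta
                   * (fine (char mu U s%:E r%:E w w)) `^ (s / s0)))%:E
           * Lnorm mu p (fun x => (S f x * w x)%:E))%E).
Proof.
pose dl := r^-1 - inv_e r0.
have dl_gt0 : 0 < dl by rewrite -oppr_lt0 opprB.
have r0E : inv_e r0 = r^-1 - dl by rewrite /dl subKr.
have He3' : s^-1 - s0^-1 = - dl by rewrite He3 opprB.
have s0E : s0^-1 = s^-1 + dl by rewrite -[dl]opprK -He3' subKr.
have pE : inv_e p = p0^-1 - dl by rewrite -He3' -He2 subrKC.
have qE : inv_e q = q0^-1 - dl by rewrite -He3' -He2 -He1 subrKC.
pose t := (s^-1 + r^-1) * r.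
have t1 : (1 < t%:E)%E.
  by rewrite lte_fin /t mulrDl mulVf ?gt_eqF// ltrDr mulr_gt0 ?invr_gt0.
have [c1 HM] := Hc _ t1.
have [mw w_gt0] := Hw.
have muT : (0 < mu [set: Om])%E.
  have [_ [m0 _]] := HU.1 0%N; apply: lt_le_trans m0 _.
  by apply: le_measure; rewrite ?inE//; exact: basis_measurable HU 0%N.
have weightP kappa (k : Om -> R) :=
  @extrapolation_weight _ _ _ mu U HU s r s0 dl
  (c t%:E) r0 w Hs Hr Hw Hwc Hs0 Hr0 dl_gt0 s0E r0E c1 HM kappa k.
have Lw0 kappa f (h : Om -> R) : 1 < kappa -> inLw mu p w (S f) ->
    measurable_fun [set: Om] h -> (forall x, 0 <= h x) ->
    (\int[mu]_x (h x)%:E <= (kappa `^ t)%:E)%E ->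
    (Lnorm mu p0%:E (fun x => (S f x * (w x * h x `^ dl))%:E)
     <= (kappa `^ (t * dl))%:E * Lnorm mu p (fun x => (S f x * w x)%:E))%E.
  move=> k1 [mS _] mh h0 Ih.
  have kt : 0 < kappa `^ t by rewrite powR_gt0// (lt_trans ltr01).
  rewrite Lnorm_normr [X in (_ <= _ * X)%E]Lnorm_normr.
  have mSw : measurable_fun [set: Om] (fun x => `|S f x * w x|).
    by apply: measurableT_comp => //; exact: measurable_funM.
  have := Lnorm_mul_powR_le muT Hp0 dl_gt0 Hp pE kt mSw mh
    (fun x => normr_ge0 _) h0 Ih.
  rewrite -powRrM; congr (Lnorm _ _ _ <= _)%E; apply/funext => x.
  by rewrite mulrA [`|_ * w x * _|]normrM [`|h x `^ dl|]ger0_norm ?powR_ge0.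
split.
  (* For membership in the domain any admissible weight will do; kappa = 2 and k = e are arbitrary
     choices. *)
  move=> f Lf; have [e [me e0 e1]] := sigma_finite_pos_integrable Hsf.
  have [h [[mh eh] Ih Hwh charh]] := weightP 2 e (ltr1n _ 2) me e0 e1.
  exists (fun x => w x * h x `^ dl); split => //; split.
    exact: le_lt_trans charh (ltry _).
  split; first exact: HS.
  have h0 x : 0 <= h x by rewrite (le_trans _ (eh x))// ltW.
  apply: le_lt_trans (Lw0 2 f h (ltr1n _ 2) Lf mh h0 Ih) _.
  by rewrite lte_mul_pinfty ?lee_fin ?powR_ge0//; case: Lf.
move=> kappa k1 f Lf; cbv zeta; rewrite !invrK -/t -/dl.
rewrite [_ * dl * r]mulrAC -/t.
have [mS Sfin] := Lf.
have N0 : (0 <= Lnorm mu p (fun x => (S f x * w x)%:E))%E by exact: Lnorm_ge0.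
have Nfin : Lnorm mu p (fun x => (S f x * w x)%:E) \is a fin_num.
  by rewrite ge0_fin_numE.
set bound := (X in phi X); set N := Lnorm mu p _ in N0 Nfin *.
pose C := kappa `^ (t * dl) * phi bound * fine N.
(* The facts [0 <= C] and measurability of [T f] do not involve k, but both are obtained through a
   weight w0 built from some k. They are extracted later by taking k = e. *)
have keyP (k : Om -> R) : measurable_fun [set: Om] k -> (forall x, 0 < k x) ->
    (\int[mu]_x (k x)%:E <= 1)%E ->
    0 <= C /\
    (Lnorm mu q0%:E (fun x => (`|T f x * w x| * k x `^ dl)%:E) <= C%:E)%E /\
    measurable_fun [set: Om] (T f).
  move=> mk k0 Ik; have [h [[mh kh] Ih Hwh charh]] :=
    weightP kappa k k1 mk k0 Ik.
  have h_gt0 x : 0 < h x by exact: lt_le_trans (kh x).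
  have h0 x : 0 <= h x by exact: ltW.
  pose w0 x := w x * h x `^ dl.
  have Hchar : (char mu U s0%:E r0 w0 w0 < +oo)%E
    by exact: le_lt_trans charh (ltry _).
  have HN := Lw0 kappa f h k1 Lf mh h0 Ih; rewrite -/w0 -/N in HN.
  have Lf0 : inLw mu p0%:E w0 (S f).
    split => //; apply: le_lt_trans HN _.
    by rewrite lte_mul_pinfty ?lee_fin ?powR_ge0.
  have mT : measurable_fun [set: Om] (T f) by apply: HTm; exists w0.
  have HTf := HT w0 Hwh Hchar f Lf0.
  set N' := Lnorm mu p0%:E (fun x => (S f x * w0 x)%:E) in HN HTf.
  have N'0 : (0 <= N')%E by exact: Lnorm_ge0.
  have phi_le : phi (fine (char mu U s0%:E r0 w0 w0)) <= phi bound.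
    apply: Hphi; rewrite -lee_fin fineK//.
    by rewrite ge0_fin_numE ?char_ge0.
  have {}HTf : (Lnorm mu q0%:E (fun x =>
    (T f x * w0 x)%:E) <= (phi bound)%:E * N')%E.
    by apply: le_trans HTf _; rewrite lee_wpmul2r ?lee_fin.
  have CE : (C%:E = (phi bound)%:E * ((kappa `^ (t * dl))%:E * N))%E.
    by rewrite /C EFinM fineK// EFinM muleAC muleA muleC muleA.
  have mTw : measurable_fun [set: Om] (fun x => `|T f x * w x|).
    by apply: measurableT_comp => //; exact: measurable_funM.
  have Tw0 : (Lnorm mu q0%:E (fun x => (`|T f x * w x| * k x `^ dl)%:E)
              <= Lnorm mu q0%:E (fun x => (T f x * w0 x)%:E))%E.
    have -> : Lnorm mu q0%:E (fun x => (T f x * w0 x)%:E)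
            = Lnorm mu q0%:E (fun x => (`|T f x * w x| * h x `^ dl)%:E).
      rewrite Lnorm_normr; congr Lnorm; apply/funext => x.
      by rewrite /w0 mulrA normrM [`|h x `^ dl|]ger0_norm ?powR_ge0.
    apply: le_Lnorm_ge0 => //.
    - by apply: measurable_funM => //; exact: measurable_fun_powR.
    - by apply: measurable_funM => //; exact: measurable_fun_powR.
    - by move=> x; rewrite mulr_ge0 ?powR_ge0.
    - move=> x; rewrite ler_wpM2l//; apply: ler_powR2r; rewrite ?(ltW dl_gt0)//.
      exact: ltW.
  (* The function phi may be negative. In that case [HTf] forces the norm of [S f] in L^(p0) with
     weight w0 to vanish, so [S f] = 0 almost everywhere because w0 > 0, and both sides of the claim
     reduce to 0. *)
  have [phi0|phi0] := leP 0 (phi bound).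
    split; first by rewrite /C !mulr_ge0 ?powR_ge0 ?fine_ge0.
    split => //; apply: (le_trans Tw0); apply: (le_trans HTf).
    by rewrite CE lee_wpmul2l ?lee_fin.
  have N'_eq0 : N' = 0%E.
    apply/eqP; rewrite eq_le N'0 andbT leNgt; apply/negP => N'_gt0.
    have : (0 <= (phi bound)%:E * N')%E
      by exact: le_trans (Lnorm_ge0 _ _ _) HTf.
    by rewrite leNgt mule_lt0_gt0.
  have N_eq0 : N = 0%E.
    have mSw0 : measurable_fun [set: Om] (fun x => (S f x * w0 x)%:E).
      by apply/measurable_EFinP/measurable_funM => //; case: Hwh.
    have p0E : (0 < p0%:E)%E by rewrite lte_fin.
    apply: ae_eq0_Lnorm => //; first exact: measurable_funM.
    apply: filterS (Lnorm_eq0_eq0 mSw0 p0E N'_eq0) => x /(_ Logic.I) [].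
    move=> /eqP; rewrite mulf_eq0 => /orP[/eqP ->|]; first by rewrite mul0r.
    by rewrite gt_eqF//; case: Hwh => _; exact.
  have C0 : C = 0 by rewrite /C N_eq0 mulr0.
  rewrite C0; split => //; split => //.
  by apply: (le_trans Tw0); apply: (le_trans HTf); rewrite N'_eq0 mule0.
have [e [me e0 e1]] := sigma_finite_pos_integrable Hsf.
have [C0 [_ mT]] := keyP e me e0 e1.
rewrite -[N]fineK// -EFinM -/C Lnorm_normr.
apply: (Lnorm_le_duality Hsf Hq0 dl_gt0 C0 Hq qE) => //.
  by apply: measurableT_comp => //; exact: measurable_funM.
by move=> k mk k0 Ik; have [_ []] := keyP k mk k0 Ik.
Qed.
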